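(* Let $Z$ be a complex random variable with $\mathbb{E} Z=0$ and $\operatorname{diam} Z=d\le d_0$. Then \[ \bigl|\mathbb{E}\, e^{Z}-1\bigr|\le G(d). \]
   Context: For a complex random variable $Z$, the diameter of $Z$ is \[ \operatorname{diam} Z = \inf\,\{ c\in\mathbb{R} : P(|Z_1-Z_2|>c)=0\}, \] where $Z_1,Z_2$ are independent copies of $Z$, and the infimum of the empty set is taken to be $\infty$. $\mathcal{Z}_d$ denotes the class of all complex random variables $Z$ with $\mathbb{E} Z=0$ and $\operatorname{diam} Z\le d$. Define \[ d_0=\sup\,\{ d\in\mathbb{R} : \operatorname{Re}\,\mathbb{E}\, e^Z\ge 0 \text{ for all } Z\in\mathcal{Z}_d\}. \] For $d>0$, let $X_d$ be the random variable supported on $\{0,d\}$ with $P(X_d=d)=\frac{e^d-1-d}{d(e^d-1)}$, and define $G(d)=\mathbb{E}\,e^{X_d-\mathbb{E}X_d}-1$; explicitly \[ G(d)=\frac{\exp\Bigl(-\frac{e^d-1-d}{e^d-1}\Bigr)-2\exp\Bigl(\frac{d e^d-e^d+1}{e^d-1}\Bigr)+\exp\Bigl(\frac{2d e^d-e^d-d+1}{e^d-1}\Bigr)}{d(e^d-1)}-1. \] By continuity, $G(0)=0$. *)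

(* Defs.v *)
From HB Require Import structures.
From mathcomp Require Import all_boot all_order all_algebra.
From mathcomp Require Export complex.
From mathcomp Require Import ring lra.
From mathcomp Require Import all_classical all_reals all_analysis.
Set Implicit Arguments.
Unset Strict Implicit.
Unset Printing Implicit Defensive.
Import Order.TTheory GRing.Theory Num.Theory.
Import numFieldNormedType.Exports.
Local Open Scope classical_set_scope.
Local Open Scope ring_scope.
Local Open Scope complex_scope.

Section ComplexRandomVariables.
Context {d : measure_display} {T : measurableType d} {R : realType}.
Variable P : probability T R.
Implicit Type Z : T -> R[i].

(* Equivalent to Borel measurability, since the Borel sigma-algebra of C is
   generated by the real and imaginary parts. *)
Definition complex_rv Z : Prop :=
  measurable_fun [set: T] (fun w => complex.Re (Z w)) /\
  measurable_fun [set: T] (fun w => complex.Im (Z w)).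

Definition complex_integrable Z : Prop :=
  P.-integrable [set: T] (fun w => (complex.Re (Z w))%:E) /\
  P.-integrable [set: T] (fun w => (complex.Im (Z w))%:E).

(* Meaningful only when Z is integrable: [fine] sends infinities to 0. *)
Definition complex_expectation Z : R[i] :=
  fine ('E_P[fun w => complex.Re (Z w)])%E +i*
  fine ('E_P[fun w => complex.Im (Z w)])%E.

Definition centered Z : Prop :=
  complex_integrable Z /\ complex_expectation Z = 0.

(* The independent copies Z_1, Z_2 of Z are realized as the two coordinates
   Z \o fst and Z \o snd on the product probability space. *)
Definition diam Z : \bar R :=
  ereal_inf [set c%:E | c in [set c : R |
    (P \x P)%E [set w : T * T | c%:C < `|Z w.1 - Z w.2|] = 0%E]].

End ComplexRandomVariables.

Definition cexp {R : realType} (z : R[i]) : R[i] :=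
  (expR (complex.Re z) * cos (complex.Im z)) +i*
  (expR (complex.Re z) * sin (complex.Im z)).

Definition class_Z {R : realType} (r : R) {d : measure_display}
    {T : measurableType d} (P : probability T R) (Z : T -> R[i]) : Prop :=
  [/\ complex_rv Z, centered P Z & (diam P Z <= r%:E)%E].

Definition d0 (R : realType) : \bar R :=
  ereal_sup [set r%:E | r in [set r : R |
    forall (d : measure_display) (T : measurableType d)
      (P : probability T R) (Z : T -> R[i]),
      class_Z r P Z ->
      0 <= complex.Re (complex_expectation P (fun w => cexp (Z w)))]].

Section G.
Context {R : realType}.
Implicit Type d : R.

Definition prob_X d : R := (expR d - 1 - d) / (d * (expR d - 1)).

(* The random variable X_d is [Xd d] on bool under [law_X d]. *)
Definition law_X d : probability bool R := bernoulli_prob (prob_X d).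

Definition Xd d (b : bool) : R := if b then d else 0.

(* The value at 0 is the limit of the values at d > 0. *)
Definition G d : R :=
  if d == 0 then 0
  else fine ('E_(law_X d)[fun b =>
    expR (Xd d b - fine ('E_(law_X d)[Xd d])%E)])%E - 1.

Lemma prob_X01 d : 0 < d -> 0 <= prob_X d <= 1.
Proof.
move=> d0; have e1 : 0 < expR d - 1 by rewrite subr_gt0 expR_gt1.
have D0 : 0 < d * (expR d - 1) by rewrite mulr_gt0.
rewrite /prob_X divr_ge0 ?(ltW D0)//=; last first.
  by rewrite -addrA -opprD subr_ge0 expR_ge1Dx.
rewrite ler_pdivrMr// mul1r.
have := expR_ge1Dx (- d); rewrite -(ler_pM2r (expR_gt0 d)) -expRD addNr expR0.
lra.
Qed.

Lemma G_explicit d : 0 < d ->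
  G d = (expR (- ((expR d - 1 - d) / (expR d - 1)))
         - 2 * expR ((d * expR d - expR d + 1) / (expR d - 1))
         + expR ((2 * d * expR d - expR d - d + 1) / (expR d - 1)))
        / (d * (expR d - 1)) - 1.
Proof.
move=> d0; have p01 := prob_X01 d0.
have e1 : expR d - 1 != 0 by rewrite gt_eqF// subr_gt0 expR_gt1.
have dn0 : d != 0 by rewrite gt_eqF.
rewrite /G (negbTE dn0); congr (_ - 1).
rewrite unlock /= (integral_bernoulli_prob p01); last first.
  by move=> b; rewrite lee_fin expR_ge0.
rewrite (integral_bernoulli_prob p01); last first.
  by move=> [] /=; rewrite lee_fin// ltW.
rewrite /Xd /= /unstable.onem mulr0 addr0 sub0r expRD.
set m := prob_X d * d.
have mE : m = (expR d - 1 - d) / (expR d - 1).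
  by rewrite /m /prob_X; field; rewrite e1.
have -> : (d * expR d - expR d + 1) / (expR d - 1) = d - m.
  by rewrite mE; field.
have -> : (2 * d * expR d - expR d - d + 1) / (expR d - 1) = d + d - m.
  by rewrite mE; field.
rewrite -mE !expRD /prob_X; field; exact/andP.
Qed.

End G.

(* Main.v *)
(* After discretization, Z has finite support S of diameter at most d1 < d0; write
   F = E e^(Z - E Z) as a function of the masses on S, and let |F - 1| be maximal.

   If S spans the plane, the masses can be perturbed by +-t v so that the mean moves
   by +-tD, for any D in C. Linearity in the masses gives
     F = (e^(tD) F_+ + e^(-tD) F_-) / 2   with |F_+ - 1|, |F_- - 1| <= |F - 1|,
   and to second order in t this excludes the directions D where a certain real
   quadratic form is negative. Its discriminant is |F - 1|^2 Re F, so such a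
   direction exists because Re F > 0, which is what d1 < d0 provides. Hence S lies
   on a line, and Z is a mixture of centered two-point laws on that line.

   For a two-point law on {-a w, b w} with |w| = 1 and a <= b (up to w -> -w),
   |e^(b t w) - e^(-a t w)| <= e^(b t) - e^(-a t) reduces the claim to w = 1,
   where optimality of the mass of X_d is the inequality 1 + x <= e^x. *)
Require Import Defs.
From HB Require Import structures.
From mathcomp Require Import all_boot all_order all_algebra.
From mathcomp Require Import complex.
From mathcomp Require Import ring lra.
From mathcomp Require Import all_classical all_reals all_analysis.
From mathcomp Require Import measurable_realfun.
Set Implicit Arguments.
Unset Strict Implicit.
Unset Printing Implicit Defensive.
Import Order.TTheory GRing.Theory Num.Theory.
Import numFieldNormedType.Exports.
Import Normc.
Local Open Scope classical_set_scope.
Local Open Scope ring_scope.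
Local Open Scope complex_scope.

Local Notation Re := (@complex.Re _).
Local Notation Im := (@complex.Im _).

(** * Modulus, real part and imaginary part *)

Section ComplexModulus.
Context {R : realType}.
Implicit Types z w : R[i].

Lemma sqr_normc2 z : normc z ^+ 2 = Re z ^+ 2 + Im z ^+ 2.
Proof. by case: z => a b /=; rewrite sqr_sqrtr ?addr_ge0 ?sqr_ge0. Qed.

Lemma normc_ge0 z : 0 <= normc z.
Proof. by case: z => a b /=; rewrite sqrtr_ge0. Qed.

Lemma normc_eq0 z : (normc z == 0) = (z == 0).
Proof. by apply/eqP/eqP => [/eq0_normc//|->]; rewrite normc0. Qed.

Lemma normc_real (x : R) : normc x%:C = `|x|.
Proof. by rewrite /= expr0n addr0 sqrtr_sqr. Qed.

Lemma normc_Re z : `|Re z| <= normc z.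
Proof.
rewrite -(@ler_pXn2r _ 2) ?nnegrE ?normr_ge0 ?normc_ge0//.
by rewrite sqr_normc2 -normrX ger0_norm ?sqr_ge0// lerDl sqr_ge0.
Qed.

Lemma normc_Im z : `|Im z| <= normc z.
Proof.
rewrite -(@ler_pXn2r _ 2) ?nnegrE ?normr_ge0 ?normc_ge0//.
by rewrite sqr_normc2 -normrX [X in X <= _]ger0_norm ?sqr_ge0// lerDr sqr_ge0.
Qed.

Lemma normc_le_ReIm z : normc z <= `|Re z| + `|Im z|.
Proof.
rewrite -(@ler_pXn2r _ 2) ?nnegrE ?addr_ge0 ?normr_ge0 ?normc_ge0//.
rewrite sqr_normc2 -(real_normK (num_real (Re z))) -(real_normK (num_real (Im z))).
have := mulr_ge0 (normr_ge0 (Re z)) (normr_ge0 (Im z)); nra.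
Qed.

Lemma ler_normc_sum (I : Type) (s : seq I) (Q : pred I) (F : I -> R[i]) :
  normc (\sum_(i <- s | Q i) F i) <= \sum_(i <- s | Q i) normc (F i).
Proof.
elim/big_ind2 : _ => [|z x w y zx wy|//]; first by rewrite normc0.
exact: le_trans (le_normcD _ _) (lerD zx wy).
Qed.

Lemma normcB z w : normc (z - w) = normc (w - z).
Proof. by rewrite -normcN opprB. Qed.

Lemma ReDc z w : Re (z + w) = Re z + Re w.
Proof. by case: z; case: w. Qed.

Lemma ImDc z w : Im (z + w) = Im z + Im w.
Proof. by case: z; case: w. Qed.

Lemma ReNc z : Re (- z) = - Re z. Proof. by case: z. Qed.

Lemma ImNc z : Im (- z) = - Im z. Proof. by case: z. Qed.

Lemma ReMc z w : Re (z * w) = Re z * Re w - Im z * Im w.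
Proof. by case: z; case: w. Qed.

Lemma ImMc z w : Im (z * w) = Re z * Im w + Im z * Re w.
Proof. by case: z; case: w. Qed.

Lemma Re_sum (I : Type) (s : seq I) (Q : pred I) (F : I -> R[i]) :
  Re (\sum_(i <- s | Q i) F i) = \sum_(i <- s | Q i) Re (F i).
Proof. by elim/big_ind2 : _ => [//|z x w y <- <-|//]; rewrite ReDc. Qed.

Lemma Im_sum (I : Type) (s : seq I) (Q : pred I) (F : I -> R[i]) :
  Im (\sum_(i <- s | Q i) F i) = \sum_(i <- s | Q i) Im (F i).
Proof. by elim/big_ind2 : _ => [//|z x w y <- <-|//]; rewrite ImDc. Qed.

Lemma complex_eqP z w : Re z = Re w -> Im z = Im w -> z = w.
Proof. by case: z => a b; case: w => c e /= -> ->. Qed.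

(** The choice w = conj(z)/|z| gives Re (w z) = |z|. Bounds on a modulus thus reduce to real
    functions, to which the mean value theorem applies. *)
Lemma normc_le_dual z (B : R) : 0 <= B ->
  (forall w, normc w = 1 -> Re (w * z) <= B) -> normc z <= B.
Proof.
move=> B0 H; have [->|z0] := eqVneq z 0; first by rewrite normc0.
have n0 : normc z != 0 by rewrite normc_eq0.
have := H ((normc z)^-1%:C * (z^*)%C).
rewrite normcM normc_real ger0_norm ?invr_ge0 ?normc_ge0//.
have -> : normc (z^*)%C = normc z by case: (z) => a b /=; rewrite sqrrN.
rewrite mulVf// => /(_ erefl); apply: le_trans.
have -> : Re ((normc z)^-1%:C * (z^*)%C * z) = (normc z)^-1 * normc z ^+ 2.
  by rewrite sqr_normc2; case: (z) => a b /=; ring.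
by rewrite expr2 mulKf.
Qed.

End ComplexModulus.

(** * Inequalities for the complex exponential *)

Section ComplexExponential.
Context {R : realType}.
Implicit Types z w : R[i].

Lemma cexpD z w : cexp (z + w) = cexp z * cexp w.
Proof.
apply: complex_eqP.
  by rewrite ReMc /cexp /= ReDc ImDc expRD cosD; ring.
by rewrite ImMc /cexp /= ReDc ImDc expRD sinD; ring.
Qed.

Lemma cexp0 : cexp 0 = 1 :> R[i].
Proof. by apply: complex_eqP; rewrite /cexp /= ?expR0 ?cos0 ?sin0 ?mulr1 ?mulr0. Qed.

Lemma normc_cexp z : normc (cexp z) = expR (Re z).
Proof.
rewrite /cexp /= !exprMn -mulrDr cos2Dsin2 mulr1 sqrtr_sqr ger0_norm//.
Qed.

Lemma le0_deriv_seg (f f' : R -> R) (a : R) :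
  (forall y : R, is_derive y (1 : R) f (f' y)) ->
  (forall y, 0 <= y -> y <= a -> 0 <= f' y) ->
  forall x, 0 <= x -> x <= a -> f 0 <= f x.
Proof.
move=> df f'0 x x0 xa.
have fc : {within `[0, x], continuous f}.
  apply: continuous_subspaceT => y; apply: differentiable_continuous.
  by apply/derivable1_diffP; have [] := df y.
have [c + D] := MVT_segment x0 (fun y _ => df y) fc.
rewrite in_itv /= => /andP[c0 cx].
by rewrite -subr_ge0 D mulr_ge0 ?subr0// f'0// (le_trans cx).
Qed.

Lemma le0_deriv (f f' : R -> R) (x : R) :
  (forall y : R, is_derive y (1 : R) f (f' y)) ->
  (forall y, 0 <= y -> 0 <= f' y) -> 0 <= x -> f 0 <= f x.
Proof.
move=> df f'0 x0; apply: (@le0_deriv_seg f f' x df) => // y y0 _.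
exact: f'0.
Qed.

Lemma is_derive_mull (k x : R) : is_derive x (1 : R) (fun t : R => k * t) k.
Proof.
have := @is_deriveZ R R R^o id k x 1 1 (is_derive_id _ _).
by rewrite /GRing.scale /= mulr1.
Qed.

Global Instance is_derive_expRZ (k x : R) :
  is_derive x 1 (fun t => expR (k * t)) (k * expR (k * x)).
Proof.
have h : is_derive x 1 (fun t : R => k * t) k.
  exact: is_derive_mull.
have := @is_derive1_comp R expR (fun t => k * t) x (expR (k * x)) k.
by rewrite [expR _ * k]mulrC => /(_ (is_derive_expR _) h).
Qed.

(** The difference vanishes at 0 and has derivative e^t + e^(-t) - 2 = (e^t - 1)^2 / e^t. *)
Lemma expR_sub_ge (t : R) : 0 <= t -> 2 * t <= expR t - expR (- t).
Proof.
move=> t0; rewrite -subr_ge0.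
have := @le0_deriv (fun y => expR (1 * y) - expR (-1 * y) - 2 * y)
  (fun y => expR (1 * y) + expR (-1 * y) - 2) t.
rewrite !mulr0 expR0 !subrr mul1r mulN1r; apply => //.
  move=> y; apply: is_derive_eq.
  by rewrite /GRing.scale /=; ring.
move=> y y0; rewrite mul1r mulN1r expRN.
have := expR_gt0 y; move: (expR y) => e e0.
have -> : e + e^-1 - 2 = (e - 1) ^+ 2 / e by field; lra.
by rewrite divr_ge0 ?sqr_ge0 ?ltW.
Qed.

Lemma sqr_sin_le (y : R) : sin y ^+ 2 <= y ^+ 2.
Proof.
wlog y0 : y / 0 <= y => [H|].
  have [/H//|/ltW y0] := leP 0 y.
  by rewrite -sqrrN -sinN -[y ^+ 2]sqrrN H// oppr_ge0.
have h1 : sin y <= y.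
  rewrite -subr_ge0.
  have := @le0_deriv (fun t => t - sin t) (fun t => 1 - cos t) y.
  rewrite sin0 subrr; apply; last exact: y0.
  by move=> t _; rewrite subr_ge0 cos_le1.
have h2 : - y <= sin y.
  rewrite -subr_ge0 opprK.
  have := @le0_deriv (fun t => sin t + t) (fun t => cos t + 1) y.
  rewrite sin0 addr0; apply; last exact: y0.
  by move=> t _; have := cos_geN1 t; lra.
by rewrite -subr_ge0 subr_sqr mulr_ge0//; lra.
Qed.

(* |sinh z| <= sinh |z|, doubled: |2 sinh z|^2 = (2 sinh x)^2 + (2 sin y)^2. *)
Lemma normc_sinh_le z :
  normc (cexp z - cexp (- z)) <= expR (normc z) - expR (- normc z).
Proof.
set p := normc z; have p0 : 0 <= p by exact: normc_ge0.
have P0 : 0 <= expR p - expR (- p) by apply: le_trans (expR_sub_ge p0); lra.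
rewrite -(@ler_pXn2r _ 2) ?nnegrE ?normc_ge0//.
have pE : p ^+ 2 = Re z ^+ 2 + Im z ^+ 2 := sqr_normc2 z.
have /ler_normlP[x1 x2] := normc_Re z; rewrite -/p in x1 x2.
move: pE x1 x2; case: z @p p0 P0 => x y p p0 P0 /= pE x1 x2.
rewrite /= sqr_sqrtr ?addr_ge0 ?sqr_ge0// cosN sinN.
have := sqr_sin_le y; have := cos2Dsin2 y.
have a0 : 0 <= p + x by lra.
have b0 : 0 <= p - x by lra.
(* Since sinh (p + x) sinh (p - x) = sinh^2 p - sinh^2 x, multiplying sinh t >= t at t = p + x and t
   = p - x gives sinh^2 p - sinh^2 x >= p^2 - x^2 = y^2 >= sin^2 y. *)
have := ler_pM (mulr_ge0 (ler0n R 2) a0) (mulr_ge0 (ler0n R 2) b0)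
  (expR_sub_ge a0) (expR_sub_ge b0).
rewrite !opprD !opprK !expRD.
have : expR x * expR (- x) = 1 by rewrite expRxMexpNx_1.
have : expR p * expR (- p) = 1 by rewrite expRxMexpNx_1.
move: (expR x) (expR (-x)) (expR p) (expR (-p)) (sin y) (cos y) => e f g h s c.
move=> gh ef H cs sy.
have -> : (e * c - f * c) ^+ 2 + (e * s - f * - s) ^+ 2 =
  (e ^+ 2 + f ^+ 2) * (c ^+ 2 + s ^+ 2) - 2 * (e * f) * (c ^+ 2 - s ^+ 2) by ring.
have -> : (g - h) ^+ 2 = g ^+ 2 + h ^+ 2 - 2 * (g * h) by ring.
have E2 : (g * e - h * f) * (g * f - h * e) =
  (g ^+ 2 + h ^+ 2) * (e * f) - (g * h) * (e ^+ 2 + f ^+ 2) by ring.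
rewrite E2 gh ef !mulr1 !mul1r in H.
rewrite cs gh ef !mulr1.
have -> : c ^+ 2 = 1 - s ^+ 2 by rewrite -cs addrK.
nra.
Qed.

(** With h = z/2, e^z - 1 = e^h (e^h - e^(-h)). Each factor is bounded in modulus by its value at
    |h|, and these values multiply to e^|z| - 1. *)
Lemma normc_cexpB1_le z : normc (cexp z - 1) <= expR (normc z) - 1.
Proof.
pose h := (2^-1)%:C * z.
have hh : h + h = z.
    by rewrite /h -mulrDl -rmorphD /= -{1}[2^-1]mul1r -{2}[2^-1]mul1r -splitr mul1r.
have -> : cexp z - 1 = cexp h * (cexp h - cexp (- h)).
  by rewrite mulrBr -!cexpD hh subrr cexp0.
have -> : normc z = normc h + normc h.
  rewrite /h normcM normc_real ger0_norm ?invr_ge0 ?ler0n//.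
  by rewrite -mulrDl -{1}[2^-1]mul1r -{2}[2^-1]mul1r -splitr mul1r.
rewrite normcM normc_cexp.
have -> : expR (normc h + normc h) - 1 =
  expR (normc h) * (expR (normc h) - expR (- normc h)).
  by rewrite mulrBr expRxMexpNx_1 expRD.
apply: ler_pM; rewrite ?expR_ge0 ?normc_ge0 ?normc_sinh_le//.
by rewrite ler_expR (le_trans (ler_norm _))// normc_Re.
Qed.

Global Instance is_derive_Re_cexp (w k : R[i]) (x : R) :
  is_derive x 1 (fun t => Re (w * cexp (t%:C * k)))
    (Re (w * k * cexp (x%:C * k))).
Proof.
have E t : Re (w * cexp (t%:C * k)) =
    expR (Re k * t) * (Re w * cos (Im k * t) - Im w * sin (Im k * t)).
  by rewrite ReMc /cexp /= ReMc ImMc /= !mul0r subr0 addr0 ![t * _]mulrC; ring.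
have -> : (fun t => Re (w * cexp (t%:C * k))) = (fun t =>
    expR (Re k * t) * (Re w * cos (Im k * t) - Im w * sin (Im k * t))).
  by apply/funext.
have h : is_derive x 1 (fun t : R => Im k * t) (Im k).
  exact: is_derive_mull.
have hc : is_derive x 1 (fun t => cos (Im k * t)) (- sin (Im k * x) * Im k).
  exact: (@is_derive1_comp R cos (fun t => Im k * t)).
have hs : is_derive x 1 (fun t => sin (Im k * t)) (cos (Im k * x) * Im k).
  exact: (@is_derive1_comp R sin (fun t => Im k * t)).
apply: is_derive_eq; rewrite /GRing.scale /=.
rewrite !ReMc !ImMc /cexp /= !ReMc !ImMc /= !mul0r subr0 addr0 ![x * _]mulrC.
by ring.
Qed.

(* Both sides are integrals over [0, 1] of their derivatives along t -> t w, and
   |e^(btw) - e^(-atw)| <= e^(bt) - e^(-at) as soon as a <= b. *)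
Lemma two_point_complex_le (a b : R) (w : R[i]) : 0 <= a -> a <= b ->
  normc w = 1 ->
  normc (b%:C * (cexp (- a%:C * w) - 1) + a%:C * (cexp (b%:C * w) - 1)) <=
  b * (expR (- a) - 1) + a * (expR b - 1).
Proof.
move=> a0 ab w1; have b0 := le_trans a0 ab.
apply: normc_le_dual => [|v v1].
  have := expR_ge1Dx (- a); have := expR_ge1Dx b => h1 h2.
  have : 0 <= b * (expR (-a) - 1 + a) by rewrite mulr_ge0//; lra.
  have : 0 <= a * (expR b - 1 - b) by rewrite mulr_ge0//; lra.
  lra.
pose f (t : R) := b * (expR (- a * t) - 1) + a * (expR (b * t) - 1)
  - (Re (v * b%:C * cexp (t%:C * (- a%:C * w))) - Re (v * b%:C)
     + Re (v * a%:C * cexp (t%:C * (b%:C * w))) - Re (v * a%:C)).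
pose f' (t : R) := b * (- a * expR (- a * t)) + a * (b * expR (b * t))
  - (Re (v * b%:C * (- a%:C * w) * cexp (t%:C * (- a%:C * w)))
     + Re (v * a%:C * (b%:C * w) * cexp (t%:C * (b%:C * w)))).
have df (y : R) : is_derive y (1 : R) f (f' y).
  by rewrite /f /f'; apply: is_derive_eq; rewrite /GRing.scale /=; ring.
have f0 : f 0 = 0.
  rewrite /f !mulr0 expR0 !mul0r cexp0 !mulr1; ring.
have f1 : f 1 = b * (expR (- a) - 1) + a * (expR b - 1) -
    Re (v * (b%:C * (cexp (- a%:C * w) - 1) + a%:C * (cexp (b%:C * w) - 1))).
  rewrite /f !mulr1 !mul1r !mulrDr !mulrN !mulr1 !mulrA !ReDc !ReNc; ring.
rewrite -subr_ge0 -f1 -f0; apply: (le0_deriv df) => // t t0.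
rewrite /f' subr_ge0 -ReDc.
set V := (X in Re X).
have -> : V = (a * b)%:C * (v * w *
    (cexp (t%:C * (b%:C * w)) - cexp (t%:C * (- a%:C * w)))).
  by rewrite /V rmorphM /=; ring.
have -> : b * (- a * expR (- a * t)) + a * (b * expR (b * t)) =
  (a * b) * (expR (b * t) - expR (- a * t)) by ring.
rewrite ReMc /= mul0r subr0 ler_wpM2l ?mulr_ge0//.
apply: le_trans (ler_norm _) _; apply: le_trans (normc_Re _) _.
rewrite !normcM v1 w1 !mul1r.
(* The exponents are p + q and p - q, so the difference is e^p (e^q - e^(-q)). As a <= b, |p| = t (b
   - a) / 2, and |e^p| <= e^|p| is the matching factor on the real side. *)
pose p := (t * (b - a) / 2)%:C * w; pose q := (t * (b + a) / 2)%:C * w.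
have -> : t%:C * (b%:C * w) = p + q.
  by rewrite /p /q -mulrDl -rmorphD /= mulrA -rmorphM /=; congr (_%:C * _); field.
have -> : t%:C * (- a%:C * w) = p - q.
  rewrite /p /q -mulrBl -rmorphB /= mulrA -rmorphN -rmorphM /=.
  by congr (_%:C * _); field.
rewrite !cexpD -mulrBr normcM normc_cexp.
have nq : normc q = t * (b + a) / 2.
  by rewrite /q normcM w1 mulr1 normc_real ger0_norm// divr_ge0 ?mulr_ge0 ?addr_ge0.
have np : normc p = t * (b - a) / 2.
  by rewrite /p normcM w1 mulr1 normc_real ger0_norm// divr_ge0 ?mulr_ge0 ?subr_ge0.
have -> : expR (b * t) - expR (- a * t) =
  expR (normc p) * (expR (normc q) - expR (- normc q)).
  by rewrite mulrBr -!expRD nq np; congr (expR _ - expR _); field.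
apply: ler_pM; rewrite ?expR_ge0 ?normc_ge0 ?normc_sinh_le//.
by rewrite ler_expR (le_trans (ler_norm _))// normc_Re.
Qed.

End ComplexExponential.

(** * Two-point laws and the optimal mass *)

Section TwoPointLaws.
Context {R : realType}.
Implicit Types a b d : R.

(** The two factors are E e^(X_d) and e^(-E X_d). *)
Lemma G_max d : 0 < d ->
  1 + G d = (expR d - 1) / d * expR (- ((expR d - 1 - d) / (expR d - 1))).
Proof.
move=> d_gt0; rewrite G_explicit//.
have e1 : expR d - 1 != 0 by rewrite gt_eqF// subr_gt0 expR_gt1.
have dn0 : d != 0 by rewrite gt_eqF.
set m := (expR d - 1 - d) / (expR d - 1).
have -> : (d * expR d - expR d + 1) / (expR d - 1) = d - m by rewrite /m; field.
have -> : (2 * d * expR d - expR d - d + 1) / (expR d - 1) = d + d - m.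
  by rewrite /m; field.
by rewrite !expRD; field; apply/andP.
Qed.

(** Convexity of exp between 0 and x, obtained by averaging the tangent-line bound at s x, evaluated
    at x and at 0. *)
Lemma expR_scale_le (s x : R) : 0 <= s <= 1 ->
  expR (s * x) <= s * expR x + (1 - s).
Proof.
move=> /andP[s0 s1].
have h1 : expR (s * x) * (1 + (1 - s) * x) <= expR x.
  have -> : expR x = expR (s * x) * expR ((1 - s) * x).
    by rewrite -expRD; congr expR; ring.
  by rewrite ler_wpM2l ?expR_ge0// expR_ge1Dx.
have h2 : expR (s * x) * (1 - s * x) <= 1.
  rewrite -[leRHS](expRxMexpNx_1 (s * x)) ler_wpM2l ?expR_ge0//.
  by have := expR_ge1Dx (- (s * x)).
have s1' : 0 <= 1 - s by rewrite subr_ge0.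
have := lerD (ler_wpM2l s0 h1) (ler_wpM2l s1' h2); rewrite mulr1.
by congr (_ <= _); ring.
Qed.

(** With q = E X_d, the bracket is (e^d - 1)/d times 1 + (p d - q), and 1 + u <= e^u at u = p d - q
    concludes, with equality at the mass of X_d. *)
Lemma two_point_full_range_le (p d : R) : 0 < d ->
  expR (- (p * d)) * (1 - p + p * expR d) <= 1 + G d.
Proof.
move=> d_gt0; rewrite G_max//.
have k0 : 0 < expR d - 1 by rewrite subr_gt0 expR_gt1.
set q := (expR d - 1 - d) / (expR d - 1).
have -> : expR (- q) = expR (- (p * d)) * expR (p * d - q).
  by rewrite -expRD; congr expR; ring.
rewrite mulrCA ler_wpM2l ?expR_ge0//.
have -> : 1 - p + p * expR d = (expR d - 1) / d * (1 + (p * d - q)).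
  by rewrite /q; field; rewrite !gt_eqF.
by rewrite ler_wpM2l ?expR_ge1Dx// divr_ge0 ?ltW.
Qed.

(** The centered law on {-a, b} has masses b/(a + b) and a/(a + b); everything is multiplied by a +
    b. It is the image under x -> s x, s = (a + b)/d, of the law with the same masses and gap d. By
    convexity its exponential mean [L] is at most s M + (1 - s), and 1 <= M <= 1 + G d. *)
Lemma two_point_real_le a b d : 0 <= a -> 0 <= b -> 0 < a + b -> a + b <= d ->
  b * (expR (- a) - 1) + a * (expR b - 1) <= (a + b) * G d.
Proof.
move=> a0 b0 ab0 abd; have d_gt0 := lt_le_trans ab0 abd.
pose s := (a + b) / d; pose p := a / (a + b).
have s01 : 0 <= s <= 1.
  by rewrite divr_ge0 ?(ltW ab0) ?(ltW d_gt0)//= ler_pdivrMr// mul1r.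
have [d0 ab1] : d != 0 /\ a + b != 0 by rewrite !gt_eqF.
have aE : - a = s * (- (p * d)) by rewrite /s /p; field; apply/andP.
have bE : b = s * ((1 - p) * d) by rewrite /s /p; field; apply/andP.
have h1 := expR_scale_le (- (p * d)) s01; rewrite -aE in h1.
have h2 := expR_scale_le ((1 - p) * d) s01; rewrite -bE in h2.
have h := two_point_full_range_le p d_gt0.
have e2 : expR ((1 - p) * d) = expR (- (p * d)) * expR d.
  by rewrite -expRD; congr expR; ring.
pose M := (1 - p) * expR (- (p * d)) + p * expR ((1 - p) * d).
have hM : M <= 1 + G d.
  by move: h; rewrite /M e2; congr (_ <= _); ring.
have p0 : 0 <= p by rewrite divr_ge0// ltW.
have p1 : 0 <= 1 - p.
  by rewrite subr_ge0 ler_pdivrMr// mul1r lerDl.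
have M1 : 1 <= M.
  have := lerD (ler_wpM2l p1 (expR_ge1Dx (- (p * d))))
               (ler_wpM2l p0 (expR_ge1Dx ((1 - p) * d))).
  by congr (_ <= _); rewrite /M; ring.
have := lerD (ler_wpM2l p1 h1) (ler_wpM2l p0 h2).
set L := (X in X <= _); set U := (X in _ <= X) => LU.
have UE : U = s * M + (1 - s) by rewrite /U /M; ring.
have LE : (a + b) * L = b * expR (- a) + a * expR b.
  by rewrite /L /p; field.
have L2 : L <= 1 + G d.
  apply: le_trans LU _; rewrite UE; move: s01 => /andP[s0 s1]; nra.
have -> : b * (expR (- a) - 1) + a * (expR b - 1) = (a + b) * (L - 1).
  by rewrite [RHS]mulrBr LE; ring.
by rewrite ler_wpM2l ?(ltW ab0)// lerBlDl.
Qed.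

Lemma G_ge0 d : 0 < d -> 0 <= G d.
Proof.
move=> d_gt0; have := two_point_full_range_le 0 d_gt0.
by rewrite !mul0r oppr0 expR0 !addr0 mulr1 lerDl.
Qed.

Lemma two_point_le a b d (w : R[i]) :
  0 <= a -> 0 <= b -> 0 < a + b -> a + b <= d -> normc w = 1 ->
  normc (b%:C * (cexp (- a%:C * w) - 1) + a%:C * (cexp (b%:C * w) - 1)) <=
  (a + b) * G d.
Proof.
move=> a0 b0 ab0 abd w1; have [ab|/ltW ba] := leP a b.
  exact: le_trans (two_point_complex_le a0 ab w1) (two_point_real_le _ _ _ _).
rewrite addrC [a + b]addrC; rewrite addrC in ab0 abd.
have -> : b%:C * w = - b%:C * - w by rewrite mulrNN.
have -> : - a%:C * w = a%:C * - w by rewrite mulrN mulNr.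
apply: le_trans (two_point_complex_le b0 ba _) (two_point_real_le _ _ _ _) => //.
by rewrite normcN.
Qed.

End TwoPointLaws.

(** * Laws on a line as mixtures of two-point laws *)

Section CollinearLaws.
Context {R : realType} {I : finType}.

(* A centered law on a line is a mixture of centered two-point laws: the pair
   x_i < 0 < x_j carries the weight p_i p_j (x_j - x_i) / s. *)
Lemma collinear_le (p x : I -> R) (w : R[i]) (d : R) : 0 < d ->
  (forall i, 0 <= p i) -> \sum_i p i = 1 -> \sum_i p i * x i = 0 ->
  normc w = 1 -> (forall i j, 0 < p i -> 0 < p j -> x i - x j <= d) ->
  normc (\sum_i (p i)%:C * (cexp ((x i)%:C * w) - 1)) <= G d.
Proof.
move=> d_gt0 p0 p1 px w1 xd.
pose g i := cexp ((x i)%:C * w) - 1.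
pose s := \sum_(j | 0 < x j) p j * x j.
have s0 : 0 <= s by apply: sumr_ge0 => j xj; rewrite mulr_ge0// ltW.
have sE : s = \sum_(i | x i < 0) p i * - x i.
  apply/eqP; rewrite -subr_eq0; apply/eqP; rewrite -[RHS]px.
  rewrite /s -sumrN !(big_mkcond (fun i => _ < _)) -big_split/=.
  apply: eq_bigr => i _. case: ltgtP => [xi|xi|xi].
  - by rewrite addr0.
  - by rewrite add0r mulrN opprK.
  - by rewrite -xi mulr0 addr0.
have gE : \sum_i (p i)%:C * g i =
    \sum_(i | x i < 0) (p i)%:C * g i + \sum_(j | 0 < x j) (p j)%:C * g j.
  rewrite !(big_mkcond (fun i => _ < _)) -big_split/=.
  apply: eq_bigr => i _; case: ltgtP => [xi|xi|xi]; rewrite ?addr0 ?add0r//.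
  by rewrite /g xi mul0r cexp0 subrr mulr0.
have H : s%:C * (\sum_i (p i)%:C * g i) = \sum_(i | x i < 0) \sum_(j | 0 < x j)
    (p i * p j)%:C * ((x j)%:C * g i + (- x i)%:C * g j).
  rewrite gE mulrDr {1}/s sE !rmorph_sum /=.
  rewrite mulrC !mulr_suml -big_split/=; apply: eq_bigr => i xi.
  rewrite !mulr_sumr -big_split/=; apply: eq_bigr => j xj.
  by rewrite !rmorphM /=; ring.
(* When s = 0 the weights cannot be normalized, but then all the mass sits at x = 0 and the sum
   vanishes. *)
have [s_eq0|s_neq0] := eqVneq s 0.
  have px0 i : p i != 0 -> x i = 0.
    move=> pi; have pi0 : 0 < p i by rewrite lt_neqAle eq_sym pi p0.
    case: (ltgtP (x i) 0) => // xi.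
      have nx j : x j < 0 -> 0 <= p j * - x j.
        by move=> xj; rewrite mulr_ge0// oppr_ge0 ltW.
      have := psumr_eq0P nx.
      by rewrite -sE s_eq0 => /(_ erefl i xi) /eqP; rewrite mulf_eq0 (negbTE pi)
        oppr_eq0 /= => /eqP.
    have := psumr_eq0P (fun i (xi : 0 < x i) => mulr_ge0 (p0 i) (ltW xi)).
    by rewrite -/s s_eq0 => /(_ erefl i xi) /eqP; rewrite mulf_eq0 (negbTE pi)
        /= => /eqP.
  rewrite big1 ?normc0 ?G_ge0// => i _.
  have [->|/px0 ->] := eqVneq (p i) 0; first by rewrite mul0r.
  by rewrite mul0r cexp0 subrr mulr0.
have s_gt0 : 0 < s by rewrite lt_neqAle eq_sym s_neq0.
rewrite -(ler_pM2l s_gt0).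
have -> : s * normc (\sum_i (p i)%:C * g i) =
          normc (s%:C * \sum_i (p i)%:C * g i).
  by rewrite normcM normc_real ger0_norm.
rewrite H; apply: le_trans (ler_normc_sum _ _ _) _.
apply: (@le_trans _ _ (\sum_(i | x i < 0) \sum_(j | 0 < x j)
    p i * p j * ((- x i + x j) * G d))).
  apply: ler_sum => i xi; apply: le_trans (ler_normc_sum _ _ _) _.
  apply: ler_sum => j xj; rewrite normcM normc_real ger0_norm ?mulr_ge0//.
  have [->|pi] := eqVneq (p i) 0; first by rewrite !mul0r.
  have [->|pj] := eqVneq (p j) 0; first by rewrite mulr0 !mul0r.
  have pi0 : 0 < p i by rewrite lt_neqAle eq_sym pi p0.
  have pj0 : 0 < p j by rewrite lt_neqAle eq_sym pj p0.
  rewrite ler_wpM2l ?mulr_ge0//.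
  have := @two_point_le R (- x i) (x j) d w.
  rewrite rmorphN opprK; apply; last exact: w1.
  - by rewrite oppr_ge0 ltW.
  - exact: ltW.
  - by rewrite addr_gt0// oppr_gt0.
  - by rewrite addrC xd.
(* Both one-sided first moments equal s, so the weights p_i p_j (x_j - x_i) add up to s times the
   mass off 0, which is at most s. *)
have -> : \sum_(i | x i < 0) \sum_(j | 0 < x j)
    p i * p j * ((- x i + x j) * G d) =
    s * G d * (\sum_(i | x i < 0) p i + \sum_(j | 0 < x j) p j).
  transitivity (\sum_(i | x i < 0) (p i * (s * G d) +
      p i * - x i * (G d * \sum_(j | 0 < x j) p j))).
    apply: eq_bigr => i xi; rewrite /s mulr_suml !mulr_sumr -big_split/=.
    by apply: eq_bigr => j xj; ring.
  by rewrite big_split/= -!mulr_suml -sE; ring.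
rewrite ler_piMr ?mulr_ge0 ?G_ge0// -p1 !(big_mkcond (fun i => _ < _)) -big_split/=.
by apply: ler_sum => i _; case: ltgtP => xi; rewrite ?addr0 ?add0r.
Qed.

End CollinearLaws.

(** * Finite laws as probability measures on [nat] *)

Section FiniteLawOnNat.
Context {R : realType} {n : nat} {q : nat -> {nonneg R}}.

(** A concrete probability space at which the quantifiers in [d0] can be instantiated. The argument
    [q1] lets the probability structure be inferred from the term. *)
Definition finite_law (q1 : \sum_(k < n) (q k)%:num = 1) : set nat -> \bar R :=
  msum (fun k => mscale (q k) \d_k) n.

Variable q1 : \sum_(k < n) (q k)%:num = 1.

HB.instance Definition _ := Measure.on (finite_law q1).

Let finite_law_setT : finite_law q1 setT = 1%:E.
Proof.
rewrite /finite_law /msum /= -q1 -sumEFin.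
by apply: eq_bigr => k _; rewrite /mscale /= diracT mule1.
Qed.

HB.instance Definition _ :=
  @Measure_isProbability.Build _ _ R (finite_law q1) finite_law_setT.

Lemma ge0_integral_finite_law (f : nat -> R) : (forall k, 0 <= f k) ->
  (\int[finite_law q1]_x (f x)%:E = (\sum_(k < n) (q k)%:num * f k)%:E)%E.
Proof.
move=> f0; rewrite ge0_integral_measure_sum//; last by move=> k _; rewrite lee_fin.
rewrite -sumEFin; apply: eq_bigr => k _.
rewrite ge0_integral_mscale//; last by move=> x _; rewrite lee_fin.
by rewrite integral_dirac// diracT mul1e.
Qed.

Lemma integrable_finite_law (f : nat -> R) :
  (finite_law q1).-integrable setT (EFin \o f).
Proof.
apply/integrableP; split => //.
have -> : (\int[finite_law q1]_x `|(EFin \o f) x|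
  = \int[finite_law q1]_x (`|f x|)%:E)%E by apply: eq_integral.
by rewrite ge0_integral_finite_law ?ltry// => k; exact: normr_ge0.
Qed.

Lemma integral_finite_law (f : nat -> R) :
  (\int[finite_law q1]_x (f x)%:E = (\sum_(k < n) (q k)%:num * f k)%:E)%E.
Proof.
rewrite integralE.
have -> : (fun x => (f x)%:E)^\+%E = (fun x => (Num.max (f x) 0)%:E) :> (nat -> \bar R).
  by apply/funext => x; rewrite funeposE EFin_max.
have -> : (fun x => (f x)%:E)^\-%E = (fun x => (Num.max (- f x) 0)%:E) :> (nat -> \bar R).
  by apply/funext => x; rewrite funenegE EFin_max.
rewrite !ge0_integral_finite_law; try by move=> k; rewrite le_max lexx orbT.
rewrite -EFinB -sumrB; congr EFin; apply: eq_bigr => k _; rewrite -mulrBr.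
congr (_ * _); case: (leP (f k) 0) => f0.
  by rewrite max_l ?oppr_ge0// sub0r opprK.
by rewrite max_r ?subr0// oppr_le0 ltW.
Qed.

Lemma complex_expectation_finite_law (f : nat -> R[i]) :
  complex_expectation (finite_law q1) f = \sum_(k < n) ((q k)%:num)%:C * f k.
Proof.
apply: complex_eqP; rewrite /complex_expectation /= unlock integral_finite_law /=
  ?Re_sum ?Im_sum; apply: eq_bigr => k _.
  by rewrite ReMc /= mul0r subr0.
by rewrite ImMc /= mul0r addr0.
Qed.

End FiniteLawOnNat.

(** * Sign of the real part of the exponential mean *)

Section FiniteLaws.
Context {R : realType}.
Implicit Types (I : finType) (d r : R).

Definition is_law I (p : I -> R) := (forall i, 0 <= p i) /\ \sum_i p i = 1.

Definition mean I (p : I -> R) (z : I -> R[i]) := \sum_i (p i)%:C * z i.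

(* Points of mass zero are harmless, hence the restriction to [0 < p i]. *)
Definition spread_le I (p : I -> R) (z : I -> R[i]) d :=
  forall i j, 0 < p i -> 0 < p j -> normc (z i - z j) <= d.

(** The condition defining [d0], restricted to finite laws. *)
Definition mgf_Re_ge0 r := forall I (p : I -> R) (z : I -> R[i]),
  is_law p -> mean p z = 0 -> spread_le p z r ->
  0 <= Re (mean p (fun i => cexp (z i))).

Lemma law_gt0 I (p : I -> R) : is_law p -> exists i, 0 < p i.
Proof.
move=> [p0 p1]; apply/existsP; apply: contraPT p1 => /existsPn H.
rewrite big1 ?eq_sym ?oner_eq0// => [/eqP|i _]; first by rewrite eq_sym oner_eq0.
by apply/eqP; rewrite eq_le p0 andbT leNgt H.
Qed.

Lemma lt_d0_mgf_Re_ge0 d : (d%:E < d0 R)%E -> exists2 r, d < r & mgf_Re_ge0 r.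
Proof.
move=> /ereal_sup_gt[_ [r Hr <-]]; rewrite lte_fin => dr; exists r => //.
move=> I p z lp mz sz; have [i0 pi0] := law_gt0 lp; have [p0 p1] := lp.
pose idx (k : nat) : option I := nth None (map Some (enum I)) k.
pose q (k : nat) : {nonneg R} :=
  if idx k is Some i then NngNum (p0 i) else NngNum (lexx 0).
(* Null points and indices beyond [#|I|] are sent to [z i0], a point of positive mass, so that any
   two values of [y] are within [r] and the event in [diam] is empty. *)
pose y (k : nat) : R[i] := if idx k is Some i then
  (if 0 < p i then z i else z i0) else z i0.
have sumE (g : nat -> R[i]) : \sum_(k < #|I|) ((q k)%:num)%:C * g k =
    \sum_i (p i)%:C * g (enum_rank i).
  rewrite [RHS](reindex (@enum_val I I))/=; last first.
    by exists enum_rank => i _; rewrite ?enum_valK ?enum_rankK.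
  apply: eq_bigr => k _; rewrite enum_valK /q /idx.
  by rewrite (nth_map (enum_val k)) ?size_enum_ord -?cardE// -enum_val_nth.
have yE i : 0 < p i -> y (enum_rank i) = z i.
  move=> pi; rewrite /y /idx (nth_map i) -?cardE//.
  by rewrite nth_enum_rank pi.
have sumyE (f : R[i] -> R[i]) : \sum_(k < #|I|) ((q k)%:num)%:C * f (y k) =
    mean p (fun i => f (z i)).
  rewrite (sumE (fun k => f (y k))); apply: eq_bigr => i _.
  have [->|pi] := eqVneq (p i) 0; first by rewrite !mul0r.
  by rewrite yE// lt_neqAle eq_sym pi p0.
have q1 : \sum_(k < #|I|) (q k)%:num = 1.
  have := sumE (fun=> 1); rewrite -(eq_bigr _ (fun k _ => esym (mulr1 _))).
  rewrite -[in RHS](eq_bigr _ (fun k _ => esym (mulr1 _))) -!rmorph_sum /= p1.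
  by move=> /(congr1 (@complex.Re R)).
have yr k l : normc (y k - y l) <= r.
  have yz m : exists2 i, 0 < p i & y m = z i.
    rewrite /y; case: (idx m) => [i|]; last by exists i0.
    by case: ifPn => pi; [exists i|exists i0].
  by have [i pi ->] := yz k; have [j pj ->] := yz l; exact: sz.
have := Hr _ nat (finite_law q1) y; rewrite complex_expectation_finite_law.
rewrite (sumyE cexp); apply; split.
- by split.
- split; first by split; exact: (integrable_finite_law q1).
  by rewrite complex_expectation_finite_law (sumyE id).
- apply: ereal_inf_lbound; exists r => //=.
  rewrite (_ : [set _ | _] = set0) ?measure0//.
  apply/seteqP; split => // -[k l] /= lt_r.
  have : `|y k - y l| <= r%:C by rewrite -[`|_|]/((normc _)%:C) lecR.
  by move=> /(lt_le_trans lt_r); rewrite ltxx.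
Qed.

Lemma cos_lt0 (x : R) : pi / 2 < x -> x <= pi -> cos x < 0.
Proof.
move=> x1 x2; rewrite -[x](subrK (pi / 2)) cosDpihalf oppr_lt0 sin_gt0_pi//.
by have := @pi_gt0 R; move=> ?; apply/andP; split; lra.
Qed.

(* The law of +-i rho/2 has mgf cos(rho/2). *)
Lemma mgf_Re_ge0_le_pi r : mgf_Re_ge0 r -> r <= pi.
Proof.
move=> Hr; rewrite leNgt; apply/negP => pir; have pi0 := @pi_gt0 R.
pose t := Num.min (r / 2) pi.
have t1 : pi / 2 < t by rewrite lt_min; apply/andP; split; lra.
have t2 : t <= pi by rewrite ge_min lexx orbT.
have t3 : t <= r / 2 by rewrite ge_min lexx.
pose z (b : bool) : R[i] := 0 +i* (if b then t else - t).
have H : 0 <= Re (mean (fun b : bool => 2^-1) (fun b => cexp (z b))).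
  apply: Hr.
  - by split=> [b|]; rewrite ?invr_ge0// big_bool /=; field.
  - by apply: complex_eqP; rewrite /mean big_bool /z /=; ring.
  - move=> b c _ _; apply: le_trans (normc_le_ReIm _) _.
    rewrite ReDc ImDc ReNc ImNc /= subrr normr0 add0r ler_norml.
    by case: b; case: c; apply/andP; split; lra.
have := cos_lt0 t1 t2; rewrite ltNge; apply/negP; rewrite negbK.
move: H; rewrite /mean big_bool ReDc !ReMc /= expR0 cosN !mul0r !subr0 !mul1r.
by congr (0 <= _); field.
Qed.

(** The imaginary parts lie in a band of width d < pi. After multiplication by e^(-i m), with m the
    height of the midline, every term of positive mass has positive real part. *)
Lemma mean_cexp_neq0 I (p : I -> R) (z : I -> R[i]) d :
  is_law p -> spread_le p z d -> d < pi -> mean p (fun i => cexp (z i)) != 0.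
Proof.
move=> lp sz dpi; have [i0 pi0] := law_gt0 lp; have [p0 p1] := lp.
have [j pj jmin] := @arg_minP _ _ I i0 (fun i => 0 < p i) (fun i => Im (z i)) pi0.
pose m := Im (z j) + d / 2.
have cos_gt0 i : 0 < p i -> 0 < cos (Im (z i) - m).
  move=> pi_; apply: cos_gt0_pihalf; have := jmin i pi_.
  have := le_trans (ler_norm _) (le_trans (normc_Im _) (sz _ _ pi_ pj)).
  by rewrite ImDc ImNc /m; move=> ? ?; apply/andP; split; lra.
apply/eqP => F0.
have : Re (cexp (0 +i* (- m)) * mean p (fun i => cexp (z i))) = 0.
  by rewrite F0 mulr0.
have E i : Re (cexp (0 +i* - m) * ((p i)%:C * cexp (z i))) =
    p i * (expR (Re (z i)) * cos (Im (z i) - m)).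
  rewrite mulrCA -cexpD ReMc /= mul0r subr0; congr (_ * (expR _ * cos _)).
    by rewrite ReDc add0r.
  by rewrite ImDc /= addrC.
rewrite /mean mulr_sumr Re_sum (eq_bigr _ (fun i _ => E i)).
have t0 i : 0 <= p i * (expR (Re (z i)) * cos (Im (z i) - m)).
  have [->|pi] := eqVneq (p i) 0; first by rewrite mul0r.
  have pi' : 0 < p i by rewrite lt_neqAle eq_sym pi p0.
  by rewrite !mulr_ge0 ?expR_ge0// ltW// cos_gt0.
move=> /(psumr_eq0P (fun i _ => t0 i))/(_ i0 erefl)/eqP.
by rewrite gt_eqF// !mulr_gt0 ?expR_gt0// cos_gt0.
Qed.

(* If the real part vanished, adding an independent +-h with h = delta (1 +- i)
   would rotate the (nonzero, imaginary) mgf into the left half-plane. *)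
Lemma mean_cexp_Re_gt0 I (p : I -> R) (z : I -> R[i]) d r :
  d < r -> mgf_Re_ge0 r -> is_law p -> mean p z = 0 -> spread_le p z d ->
  0 < Re (mean p (fun i => cexp (z i))).
Proof.
move=> dr Hr lp mz sz; set F := mean _ _.
have szr : spread_le p z r by move=> i j pi pj; rewrite (le_trans (sz _ _ _ _) (ltW dr)).
have dpi : d < pi := lt_le_trans dr (mgf_Re_ge0_le_pi Hr).
have F0 : F != 0 := mean_cexp_neq0 lp sz dpi.
rewrite lt_neqAle (Hr I p z)// andbT eq_sym; apply/eqP => ReF.
have ImF : Im F != 0.
  by apply: contraNneq F0 => ImF; apply/eqP; exact: complex_eqP.
have [p0 p1] := lp.
(* Since |h| <= 2e, adding +-h enlarges the spread by at most 4e <= r - d; e <= 1 ensures sin e >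
   0. *)
pose e := Num.min ((r - d) / 4) 1.
have e0 : 0 < e by rewrite lt_min ltr01 andbT divr_gt0// subr_gt0.
have e1 : e <= 1 by rewrite ge_min lexx orbT.
have er : d + 4 * e <= r.
  have : e <= (r - d) / 4 by rewrite ge_min lexx.
  lra.
(* For imaginary F, Re (F cosh h) = - Im F sinh e sin (s e), which is negative when s is the sign of
   Im F. *)
pose s : R := if 0 < Im F then 1 else -1.
pose h : R[i] := e +i* (s * e).
have s1 : `|s| = 1 by rewrite /s; case: ifP; rewrite ?normrN normr1.
have nh : normc h <= 2 * e.
  apply: le_trans (normc_le_ReIm _) _; rewrite /= normrM s1 mul1r.
  by rewrite (ger0_norm (ltW e0)); lra.
pose p' (ib : I * bool) := p ib.1 / 2.
pose z' (ib : I * bool) := z ib.1 + (if ib.2 then h else - h).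
have sum2 (T : nmodType) (f : I * bool -> T) :
    \sum_ib f ib = \sum_i (f (i, true) + f (i, false)).
  rewrite (eq_bigr (fun ib => f (ib.1, ib.2))) => [|[]//].
  by rewrite -(pair_bigA _ (fun i b => f (i, b)))/=; apply: eq_bigr => i _;
    rewrite big_bool.
have mE : mean p' (fun ib => cexp (z' ib)) =
    F * ((2^-1)%:C * (cexp h + cexp (- h))).
  rewrite /mean sum2 /F mulr_suml; apply: eq_bigr => i _.
  by rewrite /p' /z' /= !cexpD rmorphM /=; ring.
have := Hr _ p' z'; rewrite mE => H.
have : 0 <= Re (F * ((2^-1)%:C * (cexp h + cexp (- h)))).
  apply: H.
  - split=> [ib|]; first by rewrite divr_ge0.
    by rewrite sum2 -p1; apply: eq_bigr => i _; rewrite /p' -splitr.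
  - rewrite /mean sum2 -[RHS]mz; apply: eq_bigr => i _.
    rewrite /p' /z' mulrDr mulrDr mulrN addrACA subrr addr0 -mulrDl.
    by rewrite -rmorphD /= -splitr.
  - move=> [i b] [j c]; rewrite /p' /z' /= !pmulr_lgt0 ?invr_gt0// => pi pj.
    apply: le_trans er.
    have -> : z i + (if b then h else - h) - (z j + (if c then h else - h)) =
      (z i - z j) + ((if b then h else - h) - (if c then h else - h)) by ring.
    apply: le_trans (le_normcD _ _) _; apply: lerD; first exact: sz.
    apply: le_trans (le_normcD _ _) _; rewrite normcN.
    have nb (b' : bool) : normc (if b' then h else - h) = normc h.
      by case: b'; rewrite ?normcN.
    by rewrite !nb; lra.
rewrite ReMc ReF mul0r sub0r ImMc /= mul0r addr0 oppr_ge0 sinN.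
have -> : expR e * sin (s * e) + expR (- e) * - sin (s * e) =
  sin (s * e) * (expR e - expR (- e)) by ring.
have sh : 0 < expR e - expR (- e).
  by apply: lt_le_trans (expR_sub_ge (ltW e0)); lra.
have se : 0 < sin e.
  by apply: sin_gt0_pi; have := @pi_ge2 R; move=> ?; apply/andP; split; lra.
rewrite /s; case: ltP => F1.
  rewrite mul1r leNgt => /negP; apply.
  by rewrite !mulr_gt0// invr_gt0.
have F2 : Im F < 0 by rewrite lt_neqAle ImF F1.
rewrite mulN1r sinN leNgt => /negP; apply.
rewrite mulNr mulrN mulrN -mulNr.
by rewrite !mulr_gt0// ?invr_gt0// oppr_gt0.
Qed.

End FiniteLaws.

(** * Existence of a maximal law on a fixed support *)

Section Maximizer.
Context {R : realType} {I : finType}.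
Implicit Types (p : I -> R) (z : I -> R[i]).

(** Centering inside the exponential frees the masses from the mean-zero constraint: they range over
    a whole simplex. *)
Definition centered_mgf p z := mean p (fun i => cexp (z i - mean p z)).

Lemma continuous_sum (T : topologicalType) (f : I -> T -> R) :
  (forall i, continuous (f i)) -> continuous (fun x => \sum_i f i x).
Proof.
move=> cf; elim: (index_enum I) => [|i s IH] x.
  under eq_fun do rewrite big_nil; exact: cvg_cst.
under eq_fun do rewrite big_cons; apply: cvgD; [exact: cf|exact: IH].
Qed.

Lemma continuous_mul (T : topologicalType) (f g : T -> R) :
  continuous f -> continuous g -> continuous (fun x => f x * g x).
Proof. by move=> cf cg x; apply: cvgM; [exact: cf|exact: cg]. Qed.

Lemma continuous_add (T : topologicalType) (f g : T -> R) :
  continuous f -> continuous g -> continuous (fun x => f x + g x).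
Proof. by move=> cf cg x; apply: cvgD; [exact: cf|exact: cg]. Qed.

Lemma continuous_sub (T : topologicalType) (f g : T -> R) :
  continuous f -> continuous g -> continuous (fun x => f x - g x).
Proof. by move=> cf cg x; apply: cvgB; [exact: cf|exact: cg]. Qed.

(** A continuous function attains its maximum on the simplex, encoded as a closed part of the cube
    of row vectors; [i0] makes it nonempty. *)
Lemma centered_mgf_max z (i0 : I) : exists2 p, is_law p &
  forall q, is_law q ->
    normc (centered_mgf q z - 1) <= normc (centered_mgf p z - 1).
Proof.
pose P (v : 'rV[R]_#|I|) (i : I) : R := v ord0 (enum_rank i).
have cP i : continuous (fun v => P v i) by exact: coord_continuous.
pose A := [set v : 'rV[R]_#|I| | forall j, `[0, 1]%classic (v ord0 j)] `&`
          [set v | \sum_i P v i = 1].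
have lawA q : is_law q -> A (\row_j q (enum_val j)) /\
    P (\row_j q (enum_val j)) = q.
  move=> [q0 q1].
  have Pq : P (\row_j q (enum_val j)) = q.
    by apply/funext => i; rewrite /P mxE enum_rankK.
  split=> //; split=> /= [j|]; last by rewrite Pq.
  rewrite mxE in_itv /= q0 /= -q1 (bigD1 (enum_val j)) //= lerDl.
  exact: sumr_ge0.
have Alaw v : A v -> is_law (P v).
  move=> [/= v01 v1]; split=> // i.
  by have := v01 (enum_rank i); rewrite in_itv => /andP[].
have A0 : A !=set0.
  have l0 : is_law (fun i => (i == i0)%:R : R).
    split=> [i|]; first by rewrite ler0n.
    by rewrite (bigD1 i0)//= eqxx big1 ?addr0// => i /negbTE ->.
  by exists (\row_j (enum_val j == i0)%:R); have [] := lawA _ l0.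
have cA : compact A.
  apply: compact_closedI.
    have := @rV_compact R #|I| (fun=> `[0, 1]%classic) (fun=> @segment_compact R 0 1).
    by apply.
  apply: (@preimage_closed _ _ (fun v => \sum_i P v i) [set 1]).
    by move=> v _; exact: continuous_sum.
  exact: closed_eq.
pose m k v := \sum_i P v i * k (z i).
have cm (k : R[i] -> R) : continuous (m k).
  apply: continuous_sum => i; apply: continuous_mul; first exact: cP.
  exact: cst_continuous.
pose fr v := \sum_i P v i * (expR (Re (z i) - m Re v) * cos (Im (z i) - m Im v)) - 1.
pose fi v := \sum_i P v i * (expR (Re (z i) - m Re v) * sin (Im (z i) - m Im v)).
have cD i (k : R[i] -> R) : continuous (fun v => k (z i) - m k v).
  by apply: continuous_sub; [exact: cst_continuous|exact: cm].
have cE i : continuous (fun v => expR (Re (z i) - m Re v)).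
  by move=> v; exact: (continuous_comp (cD i Re v) (@continuous_expR R _)).
have cfr : continuous fr.
  apply: continuous_sub; last exact: cst_continuous.
  apply: continuous_sum => i; apply: continuous_mul; first exact: cP.
  apply: continuous_mul; first exact: cE.
  move=> v.
  exact: (continuous_comp (cD i Im v) (@continuous_cos R _)).
have cfi : continuous fi.
  apply: continuous_sum => i; apply: continuous_mul; first exact: cP.
  apply: continuous_mul; first exact: cE.
  move=> v.
  exact: (continuous_comp (cD i Im v) (@continuous_sin R _)).
have mE v : mean (P v) z = m Re v +i* m Im v.
  apply: complex_eqP; rewrite /mean ?Re_sum ?Im_sum /= /m; apply: eq_bigr => i _.
    by rewrite ReMc /= mul0r subr0.
  by rewrite ImMc /= mul0r addr0.
have FE v : centered_mgf (P v) z - 1 = fr v +i* fi v.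
  apply: complex_eqP.
    rewrite ReDc ReNc /centered_mgf mE /mean Re_sum -[RHS]/(fr v) -[Re 1]/(1 : R).
    congr (_ - _).
    by apply: eq_bigr => i _; rewrite ReMc /= mul0r subr0 ReDc ImDc ReNc ImNc.
  rewrite ImDc ImNc /centered_mgf mE /mean Im_sum -[RHS]/(fi v) -[Im 1]/(0 : R).
  rewrite oppr0 addr0.
  by apply: eq_bigr => i _; rewrite ImMc /= mul0r addr0 ReDc ImDc ReNc ImNc.
have cf : {within A, continuous (fun v => fr v ^+ 2 + fi v ^+ 2)}.
  apply: continuous_subspaceT; apply: continuous_add; apply: continuous_mul;
    by [exact: cfr|exact: cfi].
have [v /[!inE] Av maxv] := compact_EVT_max A0 cA cf.
exists (P v) => [|q lq]; first exact: Alaw.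
have [Aq Pq] := lawA q lq; have := maxv _ (mem_set Aq).
rewrite -[in X in _ -> X]Pq !FE => H.
by rewrite -(@ler_pXn2r _ 2) ?nnegrE ?normc_ge0// !sqr_normc2.
Qed.

End Maximizer.

(** * Second-order variation *)

Section SecondVariation.
Context {R : realType}.

(** By continuity f'' <= f''(0)/2 on some [0, a]; integrating twice gives f(a) <= f(0) + f''(0) a^2
    / 4 < f(0). *)
Lemma second_order_decrease (f f1 f2 : R -> R) (e : R) :
  (forall y : R, is_derive y (1 : R) f (f1 y)) ->
  (forall y : R, is_derive y (1 : R) f1 (f2 y)) ->
  {for 0, continuous f2} -> f1 0 = 0 -> f2 0 < 0 -> 0 < e ->
  exists t, [/\ 0 < t, t <= e & f t < f 0].
Proof.
move=> df df1 cf2 f10 f20 e0.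
have k0 : 0 < - f2 0 / 2 by rewrite divr_gt0// oppr_gt0.
have /cvgrPdist_lt/(_ _ k0)[e1 /= e10 H] := cf2.
pose a := Num.min e (e1 / 2).
have a0 : 0 < a by rewrite lt_min e0 divr_gt0.
have f2n y : 0 <= y -> y <= a -> f2 y <= f2 0 / 2.
  move=> y0 ya.
  have ae : a <= e1 / 2 by rewrite ge_min lexx orbT.
  have ye : y < e1 by apply: (le_lt_trans ya); apply: (le_lt_trans ae); lra.
  have := H y; rewrite /= sub0r normrN ger0_norm// => /(_ ye).
  by rewrite distrC => /ltr_normlW; lra.
have dlin (c y : R) : is_derive y (1 : R) (fun t => c * t) c.
  exact: is_derive_mull.
have f1n y : 0 <= y -> y <= a -> f1 y <= (f2 0 / 2) * y.
  move=> y0 ya.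
  have := @le0_deriv_seg R (fun t => (f2 0 / 2) * t - f1 t) (fun t => f2 0 / 2 - f2 t) a.
  rewrite f10 mulr0 subr0 => /(_ _ _ y y0 ya); rewrite subr_ge0; apply.
  by move=> x x0 xa; rewrite subr_ge0 f2n.
exists a; split => //; first by rewrite ge_min lexx.
have := @le0_deriv_seg R (fun t => (f2 0 / 4) * t ^+ 2 - f t)
  (fun t => (f2 0 / 4) * (2 * t) - f1 t) a.
rewrite expr0n mulr0 sub0r => H1.
have {}H1 : - f 0 <= f2 0 / 4 * a ^+ 2 - f a.
  apply: H1 (ltW a0) (lexx _) => [t|t t0 ta]; last first.
    by have := f1n t t0 ta; lra.
  by apply: is_derive_eq; rewrite /GRing.scale /=; ring.
suff : f2 0 / 4 * a ^+ 2 < 0.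
  by move=> Q; lra.
by rewrite nmulr_rlt0 ?exprn_gt0//; lra.
Qed.

(* Half the second derivative at t = 0 of
   Re (w (e^(tD) + e^(-tD))) + k (e^(t Re D) + e^(-t Re D)) is
   Re (w D^2) + k (Re D)^2. *)
Lemma cosh_second_order (w D : R[i]) (k e : R) :
  Re (w * (D * D)) + k * (Re D * Re D) < 0 -> 0 < e ->
  exists t, [/\ 0 < t, t <= e &
    Re (w * cexp (t%:C * D)) + Re (w * cexp (t%:C * - D)) +
    k * (expR (Re D * t) + expR (- Re D * t)) < 2 * Re w + 2 * k].
Proof.
move=> Q e0.
pose f (t : R) := Re (w * cexp (t%:C * D)) + Re (w * cexp (t%:C * - D)) +
    k * (expR (Re D * t) + expR (- Re D * t)).
pose f1 (t : R) := Re (w * D * cexp (t%:C * D)) + Re (w * - D * cexp (t%:C * - D)) +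
    k * (Re D * expR (Re D * t) + - Re D * expR (- Re D * t)).
pose f2 (t : R) := Re (w * D * D * cexp (t%:C * D)) +
    Re (w * - D * - D * cexp (t%:C * - D)) +
    k * (Re D * (Re D * expR (Re D * t)) + - Re D * (- Re D * expR (- Re D * t))).
pose f3 (t : R) := Re (w * D * D * D * cexp (t%:C * D)) +
    Re (w * - D * - D * - D * cexp (t%:C * - D)) +
    k * (Re D * (Re D * (Re D * expR (Re D * t))) +
      - Re D * (- Re D * (- Re D * expR (- Re D * t)))).
have df (t : R) : is_derive t (1 : R) f (f1 t).
  by apply: is_derive_eq; rewrite /GRing.scale /= /f1; ring.
have df1 (t : R) : is_derive t (1 : R) f1 (f2 t).
  by apply: is_derive_eq; rewrite /GRing.scale /= /f2; ring.
have df2 (t : R) : is_derive t (1 : R) f2 (f3 t).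
  by apply: is_derive_eq; rewrite /GRing.scale /= /f3; ring.
have f0 : f 0 = 2 * Re w + 2 * k.
  by rewrite /f !mul0r cexp0 !mulr0 expR0 !mulr1; ring.
have := @second_order_decrease f f1 f2 e df df1.
rewrite f0; apply => //.
- apply: differentiable_continuous; apply/derivable1_diffP.
  by have [] := df2 0.
- by rewrite /f1 !mul0r cexp0 !mulr0 expR0 !mulr1 mulrN ReNc; ring.
- rewrite /f2 !mul0r cexp0 !mulr0 expR0 !mulr1.
  have -> : w * - D * - D = w * (D * D) by ring.
  have -> : w * D * D = w * (D * D) by ring.
  by move: Q; lra.
Qed.

(* With F - 1 = u + iv and w = conj (F - 1), the form Re (w D^2) + |w|^2 (Re D)^2
   equals (u + |w|^2) x^2 + 2 v x y - u y^2, of discriminant |w|^2 (1 + u) > 0: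
   it is indefinite precisely because Re F > 0. *)
Lemma exists_negative_direction (F : R[i]) : 0 < Re F -> F - 1 != 0 ->
  exists D : R[i], Re (((F - 1)^*)%C * (D * D)) +
    normc (F - 1) ^+ 2 * (Re D * Re D) < 0.
Proof.
move=> F0 Fn; rewrite sqr_normc2.
have r0 : 0 < normc (F - 1) ^+ 2.
  by rewrite exprn_gt0// lt_neqAle eq_sym normc_eq0 Fn normc_ge0.
rewrite sqr_normc2 in r0.
have u1 : 0 < 1 + Re (F - 1) by rewrite ReDc ReNc /=; lra.
case: (F - 1) r0 u1 => u v /= r0 u1.
have [u0|u0] := ltP u 0.
  exists (u +i* v) => /=.
  have -> : u * (u * u - v * v) - - v * (u * v + v * u) +
      (u ^+ 2 + v ^+ 2) * (u * u) = u * ((u ^+ 2 + v ^+ 2) * (1 + u)) by ring.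
  by rewrite nmulr_rlt0// mulr_gt0.
set r := u ^+ 2 + v ^+ 2 in r0 *.
(* The coefficient u + r of x^2 is positive here; completing the square, x = - v minimizes the form
   at y = u + r. *)
exists (- v +i* (u + r)) => /=.
have -> : u * (- v * - v - (u + r) * (u + r)) - - v * (- v * (u + r) + (u + r) * - v)
    + r * (- v * - v) = - ((u + r) * (r * (1 + u))) + (u + r) * (r - (u ^+ 2 + v ^+ 2)).
  by ring.
rewrite subrr mulr0 addr0 oppr_lt0; apply: mulr_gt0; first lra.
exact: mulr_gt0.
Qed.

End SecondVariation.

(** * Collinearity of the maximizer and the bound for finite laws *)

Section FiniteTheorem.
Context {R : realType} {I : finType}.
Implicit Types (p : I -> R) (z : I -> R[i]).

(* The mass given to [i] and [j] is taken from all points in proportion to [p],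
   so that the mean moves by [t (a y_i + b y_j)], where [y] is the centered support. *)
Definition transfer p (i j : I) (a b t : R) (k : I) : R :=
  p k + t * (a * (k == i)%:R + b * (k == j)%:R - (a + b) * p k).

Lemma sum_delta (T : pzRingType) (f : I -> T) (i : I) :
  \sum_k (k == i)%:R * f k = f i.
Proof.
rewrite (bigD1 i)//= eqxx mul1r big1 ?addr0// => k /negbTE ->.
by rewrite mul0r.
Qed.

(** Every mean is affine in [t]. This serves for [z], whose mean moves by tD, and for the
    exponentials e^(z - m). *)
Lemma mean_transfer p i j a b t (f : I -> R[i]) :
  mean (transfer p i j a b t) f =
  mean p f + t%:C * (a%:C * (f i - mean p f) + b%:C * (f j - mean p f)).
Proof.
rewrite /mean -[in RHS](sum_delta f i) -[in RHS](sum_delta f j).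
rewrite !mulrBr !mulr_sumr -!sumrB -big_split /= mulr_sumr -big_split /=.
apply: eq_bigr => k _; rewrite /transfer !(rmorphD, rmorphM, rmorphN) /=.
by rewrite !rmorph_nat; ring.
Qed.

(** Let mu = min (p i, p j) <= 1. If |t| (|a| + |b|) <= mu/2, all masses are scaled by at least 1 -
    mu/2, which leaves at least mu/2 at [i] and [j]; the terms in t a and t b remove at most
    that. *)
Lemma transfer_law p i j a b : is_law p -> 0 < p i -> 0 < p j ->
  exists2 e, 0 < e & forall t, `|t| <= e -> is_law (transfer p i j a b t).
Proof.
move=> [p0 p1] pi pj.
pose mu := Num.min (p i) (p j); pose s := `|a| + `|b| + 1.
have s0 : 0 < s by rewrite ltr_wpDl ?addr_ge0.
have mu0 : 0 < mu by rewrite lt_min pi pj.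
have mu1 : mu <= 1.
  rewrite ge_min -p1; apply/orP; left; rewrite (bigD1 i)//= lerDl.
  exact: sumr_ge0.
exists (mu / 2 / s) => [|t te]; first by rewrite !divr_gt0.
split=> [k|]; last first.
  rewrite /transfer big_split /= p1 -mulr_sumr sumrB big_split /=.
  rewrite -!mulr_sumr p1.
  have D1 (l : I) : \sum_k (k == l)%:R = 1 :> R.
    by rewrite -[RHS](sum_delta (fun=> 1) l); apply: eq_bigr => k _; rewrite mulr1.
  by rewrite !D1; ring.
have c1 : `|t| * (`|a| + `|b|) <= mu / 2.
  move: te; rewrite ler_pdivlMr// => te; apply: le_trans te.
  by rewrite ler_wpM2l// lerDl.
have ta : `|t * a| + `|t * b| <= mu / 2 by rewrite !normrM -mulrDr.
have /ler_normlP[a1 a2] := lexx `|t * a|.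
have /ler_normlP[b1 b2] := lexx `|t * b|.
have pk := p0 k.
have E : transfer p i j a b t k = p k * (1 - t * a - t * b) +
   ((t * a) * (k == i)%:R + (t * b) * (k == j)%:R) by rewrite /transfer; ring.
rewrite E.
have x0 : 1 - mu / 2 <= 1 - t * a - t * b by lra.
have h1 : p k * (1 - mu / 2) <= p k * (1 - t * a - t * b) by rewrite ler_wpM2l.
have [->|ki] := eqVneq k i.
  have pmu : mu <= p i by rewrite ge_min lexx.
  have h2 : mu * (1 - mu / 2) <= p i * (1 - mu / 2) by rewrite ler_wpM2r//; lra.
  have h3 : p i * (1 - mu / 2) <= p i * (1 - t * a - t * b).
    by rewrite ler_wpM2l ?(ltW pi).
  have h4 : mu / 2 <= mu * (1 - mu / 2) by nra.
  by case: eqP => _; rewrite ?mulr1 ?mulr0; lra.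
have [->|kj] := eqVneq k j.
  have pmu : mu <= p j by rewrite ge_min lexx orbT.
  have h2 : mu * (1 - mu / 2) <= p j * (1 - mu / 2) by rewrite ler_wpM2r//; lra.
  have h3 : p j * (1 - mu / 2) <= p j * (1 - t * a - t * b).
    by rewrite ler_wpM2l ?(ltW pj).
  have h4 : mu / 2 <= mu * (1 - mu / 2) by nra.
  by rewrite mulr1 mulr0; lra.
by rewrite !mulr0 !addr0 mulr_ge0//; lra.
Qed.

(* If the support spans the plane, the mean can be moved by +-tD for any D, and
   F = (e^(tD) F_+ + e^(-tD) F_-)/2 with |F_+- - 1| <= |F - 1| by maximality.
   For D as in [exists_negative_direction] this is impossible for small t. *)
Lemma maximizer_collinear p z : is_law p ->
  (forall q, is_law q ->
    normc (centered_mgf q z - 1) <= normc (centered_mgf p z - 1)) ->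
  0 < Re (centered_mgf p z) -> centered_mgf p z - 1 != 0 ->
  forall i j, 0 < p i -> 0 < p j ->
    Re (z i - mean p z) * Im (z j - mean p z) =
    Im (z i - mean p z) * Re (z j - mean p z).
Proof.
move=> lp maxp; set F := centered_mgf p z => F0 F1 i j pi pj.
set m := mean p z; apply/eqP; rewrite -subr_eq0; apply/negPn/negP => det0.
have [D Q] := exists_negative_direction F0 F1.
set k := normc (F - 1) ^+ 2 in Q.
set w := ((F - 1)^*)%C in Q.
pose det := Re (z i - m) * Im (z j - m) - Im (z i - m) * Re (z j - m).
(* Cramer's rule for a (z_i - m) + b (z_j - m) = D. *)
pose a := (Re D * Im (z j - m) - Im D * Re (z j - m)) / det.
pose b := (Re (z i - m) * Im D - Im (z i - m) * Re D) / det.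
have DE : a%:C * (z i - m) + b%:C * (z j - m) = D.
  apply: complex_eqP.
    rewrite ReDc !ReMc /= !mul0r !subr0 /a /b.
    move: det0; rewrite /det; move: (Re D) (Im D) (Re (z i - m))
      (Im (z i - m)) (Re (z j - m)) (Im (z j - m)) => *.
    by field.
  rewrite ImDc !ImMc /= !mul0r !addr0 /a /b.
  move: det0; rewrite /det; move: (Re D) (Im D) (Re (z i - m))
    (Im (z i - m)) (Re (z j - m)) (Im (z j - m)) => *.
  by field.
have [e e0 le] := transfer_law a b lp pi pj.
have [t [t0 te H]] := cosh_second_order Q e0.
pose V := a%:C * (cexp (z i - m) - F) + b%:C * (cexp (z j - m) - F).
(* The factor e^(sD) undoes the shift of the mean, leaving the mean of the fixed function e^(z - m),
   which is affine in s. *)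
have FE s : cexp (s%:C * D) * centered_mgf (transfer p i j a b s) z = F + s%:C * V.
  rewrite {1}/centered_mgf (mean_transfer _ _ _ _ _ _ z) -/m DE.
  transitivity (mean (transfer p i j a b s) (fun l => cexp (z l - m))).
    rewrite /mean mulr_sumr; apply: eq_bigr => l _.
    by rewrite mulrCA -cexpD; congr (_ * cexp _); ring.
  by rewrite mean_transfer.
have tn : `|t| <= e by rewrite ger0_norm// ltW.
have tn' : `|- t| <= e by rewrite normrN.
have kw : normc w = normc (F - 1).
  by rewrite /w; case: (F - 1) => x y /=; rewrite sqrrN.
(* Maximality and |w| = |F - 1| bound the modulus by |F - 1|^2 e^(s Re D). *)
have bound s : `|s| <= e -> Re (w * (cexp (s%:C * D) *
    (centered_mgf (transfer p i j a b s) z - 1))) <= k * expR (Re D * s).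
  move=> se; apply: le_trans (ler_norm _) _; apply: le_trans (normc_Re _) _.
  rewrite !normcM kw normc_cexp /k expr2 -mulrA ler_wpM2l ?normc_ge0//.
  rewrite [leRHS]mulrC ReMc /= mul0r subr0 [s * _]mulrC ler_wpM2l ?expR_ge0//.
  exact: maxp (le _ se).
have wF : Re (w * F) = k + Re w.
  have -> : F = (F - 1) + 1 by rewrite subrK.
  rewrite mulrDr mulr1 ReDc /k sqr_normc2; congr (_ + _).
  by rewrite /w; case: (F - 1) => x y /=; ring.
have E s : w * (cexp (s%:C * D) * (centered_mgf (transfer p i j a b s) z - 1)) =
    w * F + w * (s%:C * V) - w * cexp (s%:C * D).
  by rewrite [cexp _ * (_ - 1)]mulrBr mulr1 FE; ring.
(* Adding the bounds at t and -t cancels [V]; with Re (w F) = k + Re w, the result is the reverse of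
   [H]. *)
have := lerD (bound _ tn) (bound _ tn').
rewrite !E leNgt => /negP; apply.
move: H; rewrite !(rmorphN, mulNr, mulrN) !ReDc !ReNc wF mulrDr.
by move=> H; lra.
Qed.

(** The law [p] is dominated by a maximizer [q] on the same points. The spread bound holds for all
    masses on these points, so Re F > 0 for [q]; hence [q] is collinear, unless F = 1. *)
Lemma finite_law_bound p z d d1 r : 0 < d -> d1 <= d -> d1 < r ->
  mgf_Re_ge0 r -> is_law p -> spread_le p z d1 -> normc (centered_mgf p z - 1) <= G d.
Proof.
move=> d0 d1d dr Hr lp sz; have [i0 pi0] := law_gt0 lp; have [p0 _] := lp.
(* Points of mass zero become relevant once masses are moved around. *)
pose y i := if 0 < p i then z i else z i0.
have sy (q : I -> R) : spread_le q y d1.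
  have yz k : exists2 i, 0 < p i & y k = z i.
    by rewrite /y; case: ifPn => pk; [exists k|exists i0].
  by move=> k l _ _; have [i pi ->] := yz k; have [j pj ->] := yz l; exact: sz.
have yE f : mean p (fun i => f (y i)) = mean p (fun i => f (z i)).
  apply: eq_bigr => i _; rewrite /y; case: ifPn => // pi.
  have -> : p i = 0 by apply/eqP; rewrite eq_le p0 leNgt pi.
  by rewrite !mul0r.
have -> : centered_mgf p z = centered_mgf p y.
  rewrite /centered_mgf (yE (fun u => cexp (u - mean p y))).
  by congr mean; apply/funext => i; rewrite (yE id).
have [q lq maxq] := centered_mgf_max y i0.
apply: le_trans (maxq _ lp) _.
have [q0 q1] := lq.
have mean_sub : mean q (fun i => y i - mean q y) = 0.
  rewrite /mean; under eq_bigr do rewrite mulrBr.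
  by rewrite sumrB -mulr_suml -rmorph_sum /= q1 mul1r subrr.
have [->|F1] := eqVneq (centered_mgf q y - 1) 0; first by rewrite normc0 G_ge0.
have F0 : 0 < Re (centered_mgf q y).
  apply: (mean_cexp_Re_gt0 dr Hr lq mean_sub) => i j qi qj.
  have -> : y i - mean q y - (y j - mean q y) = y i - y j by ring.
  exact: sy.
have col := maximizer_collinear lq maxq F0 F1.
set m := mean q y in mean_sub col *.
have FE : centered_mgf q y - 1 = \sum_i (q i)%:C * (cexp (y i - m) - 1).
  under eq_bigr do rewrite mulrBr mulr1.
  by rewrite sumrB -rmorph_sum /= q1.
(* If all the mass sat at the mean, F would be 1. A point off the mean gives the direction [w] of
   the line. *)
have [k qk yk] : exists2 k, 0 < q k & y k - m != 0.
  apply: contrapT => H; move/eqP: F1; apply; rewrite FE big1// => i _.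
  have [->|qi] := eqVneq (q i) 0; first by rewrite mul0r.
  have qi0 : 0 < q i by rewrite lt_neqAle eq_sym qi q0.
  have -> : y i - m = 0 by apply/eqP/negPn/negP => yi; apply: H; exists i.
  by rewrite cexp0 subrr mulr0.
pose n := normc (y k - m).
have n0 : n != 0 by rewrite normc_eq0.
pose w := (n^-1)%:C * (y k - m).
have w1 : normc w = 1.
  by rewrite normcM normc_real ger0_norm ?invr_ge0 ?normc_ge0// mulVf.
pose x i := Re ((w^*)%C * (y i - m)).
have xE i : 0 < q i -> (x i)%:C * w = y i - m.
  move=> qi; have := col _ _ qk qi; have := sqr_normc2 (y k - m).
  rewrite -/n /x /w.
  move: n0; case: (y k - m) => u v; case: (y i - m) => s t /= n0 nE cE.
  have e1 : u * s = n ^+ 2 * ((u * s) / n ^+ 2) by field.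
  apply: complex_eqP => /=.
    rewrite !mul0r !subr0 !addr0.
    transitivity ((u * (u * s) + u * (v * t)) / n ^+ 2); first by field.
    rewrite [u * (v * t)]mulrCA cE.
    by rewrite nE; field; rewrite -nE expf_neq0.
  rewrite !mul0r !subr0 !addr0.
  transitivity ((v * (v * t) + v * s * u) / n ^+ 2); first by field.
  rewrite -cE.
  by rewrite nE; field; rewrite -nE expf_neq0.
rewrite FE.
have -> : \sum_i (q i)%:C * (cexp (y i - m) - 1) =
          \sum_i (q i)%:C * (cexp ((x i)%:C * w) - 1).
  apply: eq_bigr => i _; have [->|qi] := eqVneq (q i) 0; first by rewrite !mul0r.
  by rewrite xE// lt_neqAle eq_sym qi q0.
apply: collinear_le => //.
- have : Re ((w^*)%C * mean q (fun i => y i - m)) = 0 by rewrite mean_sub mulr0.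
  rewrite /mean mulr_sumr Re_sum => E; rewrite -[RHS]E; apply: eq_bigr => i _.
  by rewrite mulrCA [RHS]ReMc /= mul0r subr0.
- move=> i j qi qj; have -> : x i - x j = Re ((w^*)%C * (y i - y j)).
    by rewrite /x -ReNc -ReDc; congr Re; ring.
  apply: le_trans (ler_norm _) _; apply: le_trans (normc_Re _) _.
  rewrite normcM.
  have -> : normc (w^*)%C = 1 by rewrite -w1; case: (w) => u v /=; rewrite sqrrN.
  by rewrite mul1r; exact: le_trans (sy q _ _ qi qj) d1d.
Qed.

End FiniteTheorem.

(** * Discretization of a random variable of finite diameter *)

Section Discretization.
Context {disp : measure_display} {T : measurableType disp} {R : realType}.
Variable P : probability T R.

Lemma measurable_superlevel d' (T' : measurableType d') (f : T' -> R) (r : R) :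
  measurable_fun setT f -> measurable [set w | r < f w].
Proof.
move=> mf; have -> : [set w | r < f w] = setT `&` f @^-1` `]r, +oo[%classic.
  by apply/seteqP; split => w /=; rewrite in_itv /= andbT; [split|case].
exact: mf.
Qed.

Lemma measurable_normc d' (T' : measurableType d') (f : T' -> R[i]) :
  measurable_fun setT (Re \o f) -> measurable_fun setT (Im \o f) ->
  measurable_fun setT (fun w => normc (f w)).
Proof.
move=> mr mi.
have -> : (fun w => normc (f w)) =
    Num.sqrt \o (fun w => (Re (f w)) ^+ 2 + (Im (f w)) ^+ 2).
  by apply/funext => w /=; case: (f w).
apply: measurableT_comp.
  by apply: continuous_measurable_fun; exact: sqrt_continuous.
by apply: measurable_funD; apply: measurable_funX.
Qed.

Lemma measurable_truncn : measurable_fun setT (fun x : R => Num.truncn x : nat).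
Proof.
move=> _ Y _; rewrite setTI.
have -> : (fun x : R => Num.truncn x) @^-1` Y =
    \bigcup_(n in Y) ((fun x : R => Num.truncn x) @^-1` [set n]).
  by apply/seteqP; split => x /=; [exists (Num.truncn x)|case=> n Yn /= ->].
apply: bigcup_measurable => n _.
(* Since [truncn] sends negative numbers to 0, the fibre over 0 is the whole half-line below 1. *)
have -> : (fun x : R => Num.truncn x) @^-1` [set n] =
    `]-oo, n.+1%:R[%classic `&` (if n is m.+1 then `[m.+1%:R, +oo[%classic else setT).
  apply/seteqP; split => x /=; rewrite in_itv /=.
    move=> <-; split; first exact: truncnS_gt.
    case E : (Num.truncn x) => [//|m] /=; rewrite in_itv /= andbT.
    by rewrite -truncn_gt_nat E.
  rewrite -truncn_le_nat => -[xn xm]; apply/eqP; rewrite eqn_leq xn /=.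
  by case: n xn xm => [//|m] _ /=; rewrite in_itv /= andbT -truncn_gt_nat.
by apply: measurableI => //; case: (n).
Qed.

Section FiniteImage.
Variables (I : finType) (iota : T -> I).
Hypothesis miota : forall i, measurable (iota @^-1` [set i]).

Definition image_law (i : I) : R := fine (P (iota @^-1` [set i])).

Lemma image_lawE i : P (iota @^-1` [set i]) = (image_law i)%:E.
Proof. by rewrite fineK// fin_num_measure. Qed.

Lemma integrable_finite_image (c : I -> R) :
  P.-integrable setT (EFin \o (fun w => c (iota w))) /\
  (\int[P]_w (c (iota w))%:E = (\sum_i image_law i * c i)%:E)%E.
Proof.
pose h i w := ((c i)%:E * (\1_(iota @^-1` [set i]) w)%:E)%E : \bar R.
have hi i : P.-integrable setT (h i).
  by apply: integrableZl => //; exact: integrable_indic.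
have E w : (c (iota w))%:E = (\sum_i h i w)%E.
  rewrite (bigD1 (iota w))//= big1 => [|i iw]; last first.
    rewrite /h indicE memNset ?mule0//= => /esym/eqP; exact/negP.
  by rewrite /h indicE mem_set// mule1 adde0.
have E' : EFin \o (fun w => c (iota w)) = (fun w => \sum_i h i w)%E.
  by apply/funext => w; exact: E.
split; first by rewrite E'; exact: integrable_sum.
rewrite (eq_integral _ _ (fun w _ => E w)) integral_sum// -sumEFin.
apply: eq_bigr => i _; rewrite /h integralZl//; last exact: integrable_indic.
by rewrite integral_indic// setIT /= image_lawE -EFinM mulrC.
Qed.

Lemma image_law_law : is_law image_law.
Proof.
split=> [i|]; first exact: fine_ge0.
have [_] := integrable_finite_image (fun=> 1).
rewrite integral_cst//= probability_setT mule1 => -[->].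
by apply: eq_bigr => i _; rewrite mulr1.
Qed.

(** [g] is integrable, as the sum of a function with finitely many values and an almost everywhere
    bounded one, so [fine] loses nothing. *)
Lemma integral_approx (g : T -> R) (c : I -> R) (e : R) :
  measurable_fun setT g -> 0 <= e ->
  {ae P, forall w, `|g w - c (iota w)| <= e} ->
  `|fine ('E_P[g])%E - \sum_i image_law i * c i| <= e.
Proof.
move=> mg e0 ge; have [ih Eh] := integrable_finite_image c.
have mh : measurable_fun setT (fun w => c (iota w)).
  by apply/measurable_EFinP; exact: measurable_int ih.
have md : measurable_fun setT (fun w => g w - c (iota w)) by exact: measurable_funB.
have le_e : (\int[P]_w `|(g w - c (iota w))%:E| <= e%:E)%E.
  apply: (@le_trans _ _ (\int[P]_w (cst e%:E w))%E).
    apply: ae_ge0_le_integral => //.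
    - by apply: measurableT_comp => //; exact/measurable_EFinP.
    - by apply: filterS ge => w gw _; rewrite lee_fin.
  by rewrite integral_cst//= probability_setT mule1.
have id : P.-integrable setT (EFin \o (fun w => g w - c (iota w))).
  apply/integrableP; split; first exact/measurable_EFinP.
  exact: le_lt_trans le_e (ltry _).
have := integralD_EFin measurableT id ih.
have -> : (\int[P]_w (EFin \o (fun w => (g w - c (iota w))%R) \+
    (EFin \o (fun w => c (iota w)))) w = \int[P]_w (g w)%:E)%E.
  by apply: eq_integral => w _ /=; rewrite -EFinD subrK.
rewrite unlock => ->; rewrite /= in Eh *; rewrite Eh.
have fd := integrable_fin_num measurableT id.
rewrite fineD// /= addrK -lee_fin.
apply: le_trans le_e; rewrite -abse_EFin fineK//.
by apply: le_abse_integral => //; exact/measurable_EFinP.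
Qed.

End FiniteImage.

Variable Z : T -> R[i].
Hypothesis mZ : complex_rv Z.

Definition spread_ae (c : R) :=
  (P \x P)%E [set w : T * T | c < normc (Z w.1 - Z w.2)] = 0%E.

Lemma measurable_spread (c : R) :
  measurable [set w : T * T | c < normc (Z w.1 - Z w.2)].
Proof.
have [mr mi] := mZ.
apply: measurable_superlevel; apply: measurable_normc.
  rewrite (_ : _ \o _ = fun w : T * T => Re (Z w.1) - Re (Z w.2)).
    by apply: measurable_funB;
      [exact: (measurableT_comp mr measurable_fst)|
       exact: (measurableT_comp mr measurable_snd)].
  by apply/funext => w /=; rewrite ReDc ReNc.
rewrite (_ : _ \o _ = fun w : T * T => Im (Z w.1) - Im (Z w.2)).
  by apply: measurable_funB;
    [exact: (measurableT_comp mi measurable_fst)|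
     exact: (measurableT_comp mi measurable_snd)].
by apply/funext => w /=; rewrite ImDc ImNc.
Qed.

Lemma diam_spread_ae (d c : R) : diam P Z = d%:E -> d < c -> spread_ae c.
Proof.
move=> dE dc; have : (diam P Z < c%:E)%E by rewrite dE lte_fin.
move=> /ereal_inf_lt[_ [c' /= c'0 <-]]; rewrite lte_fin => c'c.
apply/eqP; rewrite eq_le measure_ge0 andbT -[leRHS]c'0.
have -> : [set w : T * T | c'%:C < `|Z w.1 - Z w.2|] =
    [set w : T * T | c' < normc (Z w.1 - Z w.2)].
  by apply/seteqP; split => w /=; rewrite -[`|_|]/((normc _)%:C) ltcR.
apply: le_measure; rewrite ?inE; [exact: measurable_spread..|].
by move=> w /=; exact: lt_trans.
Qed.

(** If d < 0, then d/2 exceeds d but is still negative, so the event |Z_1 - Z_2| > d/2 has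
    probability 1. *)
Lemma diam_ge0 (d : R) : diam P Z = d%:E -> 0 <= d.
Proof.
move=> dE; rewrite leNgt; apply/negP => d0.
have d2 : d < d / 2 by lra.
have := diam_spread_ae dE d2.
rewrite /spread_ae (_ : [set _ | _] = setT `*` setT); last first.
  apply/seteqP; split => // w _ /=; apply: lt_le_trans (normc_ge0 _); lra.
by rewrite product_measure1E//= probability_setT mule1 => /eqP; rewrite onee_eq0.
Qed.

(** Some event |Z| <= n has positive probability. Its product with the event |Z| > n + |c| lies in
    the null event |Z_1 - Z_2| > c, so the second factor is null. *)
Lemma spread_ae_bounded (c : R) : spread_ae c ->
  exists2 M, 0 <= M & P [set w | M < normc (Z w)] = 0%E.
Proof.
move=> c0; have [mr mi] := mZ.
have mn : measurable_fun setT (fun w => normc (Z w)) by exact: measurable_normc.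
pose B n := ~` [set w | n%:R < normc (Z w)].
have mB n : measurable (B n) by apply: measurableC; exact: measurable_superlevel.
have [n Bn] : exists n, P (B n) != 0%E.
  apply: contrapT => H.
  have Bneg n : P.-negligible (B n).
    apply/negligibleP => //; apply: contrapT => Bn; apply: H; exists n; exact/eqP.
  have := negligible_bigcup Bneg.
  have -> : \bigcup_n B n = setT.
    apply/seteqP; split => // w _; exists (Num.truncn (normc (Z w))).+1 => //=.
    by apply/negP; rewrite -leNgt ltW// truncnS_gt.
  move/(negligibleP _ measurableT); rewrite /= probability_setT => /eqP.
  by rewrite onee_eq0.
exists (n%:R + `|c|); first by rewrite addr_ge0.
set O := [set w | _]; have mO : measurable O by exact: measurable_superlevel.
have : ((P \x P)%E (B n `*` O) <= 0)%E.
  rewrite -c0; apply: le_measure; rewrite ?inE.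
    exact: measurableX.
    exact: measurable_spread.
  move=> [x y] /= [/negP]; rewrite -leNgt /O /= => xn yn.
  have := le_normcD (Z y - Z x) (Z x); rewrite subrK normcB => yx.
  have := ler_norm c; lra.
rewrite product_measure1E// => H; apply/eqP.
have : (P (B n) * P O == 0)%E by rewrite eq_le H mule_ge0.
by rewrite mule_eq0 (negbTE Bn).
Qed.

(** A square grid over [-M, M]^2 is pulled back by [Z], and cells are represented by values of [Z]
    itself. Two cells of positive mass have a product of positive probability, so almost sure bounds
    on |Z_1 - Z_2| pass to the representatives up to the cell size. *)
Lemma discretize (M s e : R) :
  (forall c, s < c -> spread_ae c) -> P [set w | M < normc (Z w)] = 0%E ->
  0 < e ->
  exists (I : finType) (iota : T -> I) (y : I -> R[i]),
    [/\ forall i, measurable (iota @^-1` [set i]),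
        {ae P, forall w, normc (Z w) <= M /\ normc (Z w - y (iota w)) <= e},
        spread_le (image_law iota) y (s + e) &
        forall i, 0 < image_law iota i -> normc (y i) <= M].
Proof.
move=> Hs PM e0; have [mr mi] := mZ.
(* Good points of one cell differ by at most 2h = e/2, so replacing both ends of a difference costs
   at most e. *)
pose h := e / 4; have h0 : 0 < h by rewrite divr_gt0.
pose k (x : R) : nat := Num.truncn ((x + M) / h).
pose N : nat := Num.truncn ((M + M) / h).
(* [inord] sends indices out of range to 0, which concerns only the null set |Z| > M. *)
pose iota (w : T) : 'I_N.+1 * 'I_N.+1 :=
  (inord (k (Re (Z w))), inord (k (Im (Z w)))).
pose good := ~` [set w | M < normc (Z w)].
have mbad : measurable [set w | M < normc (Z w)].
  by apply: measurable_superlevel; exact: measurable_normc.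
have mgood : measurable good by exact: measurableC.
have goodE w : good w -> normc (Z w) <= M by move=> /negP; rewrite -leNgt.
have kN x : `|x| <= M -> (k x < N.+1)%N.
  move=> /ler_normlP[_ xM]; rewrite ltnS; apply: le_truncn.
  by rewrite ler_pM2r ?invr_gt0// lerD2r.
have kdist x x' : `|x| <= M -> `|x'| <= M ->
    inord (k x) = inord (k x') :> 'I_N.+1 -> `|x - x'| <= h.
  move=> xM xM' /(congr1 (@nat_of_ord _)); rewrite !inordK ?kN// => kk.
  have pos u : `|u| <= M -> 0 <= (u + M) / h.
    by move=> /ler_normlP[uM _]; rewrite divr_ge0 ?(ltW h0)//; lra.
  have /andP[a1 a2] := truncn_itv (pos _ xM).
  have /andP[b1 b2] := truncn_itv (pos _ xM').
  rewrite -/(k x) in a1 a2; rewrite -/(k x') -kk in b1 b2.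
  rewrite -natr1 in a2 b2.
  have -> : x - x' = h * ((x + M) / h - (x' + M) / h) by field; rewrite gt_eqF.
  rewrite normrM (ger0_norm (ltW h0)) ger_pMr// ler_norml.
  by apply/andP; split; lra.
have cell w w' : good w -> good w' -> iota w = iota w' ->
    normc (Z w - Z w') <= e / 2.
  move=> /goodE gw /goodE gw' [i1 i2].
  apply: le_trans (normc_le_ReIm _) _; rewrite ReDc ImDc ReNc ImNc.
  have hr := kdist _ _ (le_trans (normc_Re _) gw) (le_trans (normc_Re _) gw') i1.
  have hi := kdist _ _ (le_trans (normc_Im _) gw) (le_trans (normc_Im _) gw') i2.
  by rewrite /h in hr hi; lra.
have [rep repP] : exists rep : 'I_N.+1 * 'I_N.+1 -> T, forall w, good w ->
    good (rep (iota w)) /\ iota (rep (iota w)) = iota w.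
  have [w0 _] : exists w : T, True.
    apply: contrapT => H; have : P setT = 0%E.
      rewrite (_ : setT = set0) ?measure0//.
      by apply/seteqP; split => // w _; apply: H; exists w.
    by rewrite /= probability_setT => /eqP; rewrite onee_eq0.
  (* Cells without good points have mass zero and get the default [w0]. *)
  exists (fun i => if pselect (exists w, good w /\ iota w = i) is left ex
    then sval (cid ex) else w0) => w gw.
  case: pselect => [ex|[]]; last by exists w.
  exact: svalP (cid ex).
exists _, iota, (fun i => Z (rep i)).
have miota i : measurable (iota @^-1` [set i]).
  have mk (g : T -> R) (j : 'I_N.+1) : measurable_fun setT g ->
      measurable [set w | inord (k (g w)) = j].
    move=> mg; have mkg : measurable_fun setT (fun w => k (g w)).
      apply: (measurableT_comp measurable_truncn).
      apply: measurable_funM => //; exact: measurable_funD.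
    have := mkg measurableT [set n | inord n = j] I; rewrite setTI; exact.
  case: i => i j.
  have -> : iota @^-1` [set (i, j)] =
      [set w | inord (k (Re (Z w))) = i] `&` [set w | inord (k (Im (Z w))) = j].
    by apply/seteqP; split => w /=; [case=> -> ->|case=> <- <-].
  by apply: measurableI; exact: mk.
have cellgood i : 0 < image_law iota i -> (0 < P (iota @^-1` [set i] `&` good))%E.
  move=> pi; rewrite lt0e measure_ge0 andbT; apply/eqP => P0.
  have : (P (iota @^-1` [set i]) <= 0)%E.
    apply: (@le_trans _ _ (P ((iota @^-1` [set i] `&` good) `|`
        [set w | M < normc (Z w)]))).
      apply: le_measure; rewrite ?inE//.
        by apply: measurableU => //; exact: measurableI.
      move=> w iw; case: (pselect (good w)) => gw; first by left.
      by right; apply: contrapT.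
    have mI : measurable (iota @^-1` [set i] `&` good) by exact: measurableI.
    have mU := measureU2 P mI mbad.
    by apply: (le_trans mU); rewrite /= in P0 PM *; rewrite P0 PM adde0.
  by rewrite image_lawE// lee_fin leNgt pi.
have rep_in i : 0 < image_law iota i -> exists w, good w /\ iota w = i.
  move=> /cellgood; apply: contraPP => H.
  rewrite (_ : _ `&` _ = set0) ?measure0 ?ltxx//.
  by apply/seteqP; split => // w [/= iw gw]; apply: H; exists w.
split => //.
- exists [set w | M < normc (Z w)]; split => // w /= H.
  apply: contrapT => gw; apply: H; split; first exact: goodE.
  have [grep irep] := repP _ gw.
  have := cell _ _ gw grep (esym irep); lra.
- move=> i j pi pj; rewrite leNgt; apply/negP => far.
  (* A midpoint: above [s], hence almost surely not exceeded, yet exceeded on the product of the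
     good parts of the two cells. *)
  pose c := (s + (normc (Z (rep i) - Z (rep j)) - e)) / 2.
  have sc : s < c by rewrite /c; lra.
  have := Hs c sc; rewrite /spread_ae => c0.
  have : ((P \x P)%E ((iota @^-1` [set i] `&` good) `*` (iota @^-1` [set j] `&` good))
      <= 0)%E.
    rewrite -c0; apply: le_measure; rewrite ?inE; last first.
    + move=> [w w'] [/= [iw gw] [jw gw']].
      have [gr ir] := repP _ gw; have [gr' ir'] := repP _ gw'.
      have h1 := cell _ _ gr gw ir; have h2 := cell _ _ gw' gr' (esym ir').
      rewrite iw in h1; rewrite jw in h2.
      have := le_normcD (Z (rep i) - Z w) (Z w - Z w' + (Z w' - Z (rep j))).
      have := le_normcD (Z w - Z w') (Z w' - Z (rep j)).
      have -> : Z (rep i) - Z w + (Z w - Z w' + (Z w' - Z (rep j))) =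
        Z (rep i) - Z (rep j) by ring.
      by rewrite /c; lra.
    + exact: measurable_spread.
    + by apply: measurableX; exact: measurableI.
  rewrite product_measure1E//; [|exact: measurableI..].
  by rewrite leNgt mule_gt0 ?cellgood.
- move=> i /rep_in[w [gw <-]]; have [gr _] := repP _ gw.
  exact: goodE.
Qed.

End Discretization.

(** * Approximation errors and passage to the limit *)

Section Approximation.
Context {R : realType}.

Lemma cexp_dist (u v : R[i]) (M e : R) : normc v <= M -> normc (u - v) <= e ->
  normc (cexp u - cexp v) <= expR M * (expR e - 1).
Proof.
move=> vM uve.
have -> : cexp u - cexp v = cexp v * (cexp (u - v) - 1).
  by rewrite mulrBr mulr1 -cexpD; congr (cexp _ - _); ring.
rewrite normcM normc_cexp; apply: ler_pM; rewrite ?expR_ge0 ?normc_ge0//.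
  by rewrite ler_expR (le_trans (ler_norm _))// (le_trans (normc_Re _)).
by apply: le_trans (normc_cexpB1_le _) _; rewrite lerD2r ler_expR.
Qed.

Lemma mean_dist (I : finType) (p : I -> R) (u v : I -> R[i]) (e : R) :
  is_law p -> (forall i, 0 < p i -> normc (u i - v i) <= e) ->
  normc (mean p u - mean p v) <= e.
Proof.
move=> [p0 p1] H; rewrite /mean -sumrB.
apply: le_trans (ler_normc_sum _ _ _) _.
rewrite -[leRHS]mul1r -p1 mulr_suml; apply: ler_sum => i _.
rewrite -mulrBr normcM normc_real ger0_norm//.
have [->|pi] := eqVneq (p i) 0; first by rewrite !mul0r.
by rewrite ler_wpM2l// H// lt_neqAle eq_sym pi p0.
Qed.

(** The discretized law is centered only approximately; this is the cost of correcting its mean. *)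
Lemma mgf_centering (I : finType) (p : I -> R) (z : I -> R[i]) (M e : R) :
  is_law p -> (forall i, 0 < p i -> normc (z i) <= M) -> normc (mean p z) <= e ->
  normc (mean p (fun i => cexp (z i)) - centered_mgf p z) <=
  expR M * (expR e - 1).
Proof.
move=> lp zM me.
apply: (mean_dist lp) => i pi; rewrite normcB; apply: cexp_dist; first exact: zM.
by rewrite addrAC subrr add0r normcN.
Qed.

Lemma complex_expectation_approx (disp : measure_display)
    (T : measurableType disp) (P : probability T R) (I : finType)
    (iota : T -> I) (g : T -> R[i]) (u : I -> R[i]) (e : R) :
  (forall i, measurable (iota @^-1` [set i])) -> complex_rv g -> 0 <= e ->
  {ae P, forall w, normc (g w - u (iota w)) <= e} ->
  normc (complex_expectation P g - mean (image_law P iota) u) <= 2 * e.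
Proof.
move=> miota [mr mi] e0 H.
apply: le_trans (normc_le_ReIm _) _; rewrite ReDc ImDc ReNc ImNc.
rewrite /mean Re_sum Im_sum mulr_natl mulr2n; apply: lerD.
  rewrite (eq_bigr (fun i => image_law P iota i * Re (u i))) => [|i _]; last first.
    by rewrite ReMc /= mul0r subr0.
  apply: integral_approx => //; apply: filterS H => w; apply: le_trans.
  by rewrite -ReNc -ReDc normc_Re.
rewrite (eq_bigr (fun i => image_law P iota i * Im (u i))) => [|i _]; last first.
  by rewrite ImMc /= mul0r addr0.
apply: integral_approx => //; apply: filterS H => w; apply: le_trans.
by rewrite -ImNc -ImDc normc_Im.
Qed.

Lemma complex_rv_cexp (disp : measure_display) (T : measurableType disp)
  (Z : T -> R[i]) : complex_rv Z -> complex_rv (fun w => cexp (Z w)).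
Proof.
move=> [mr mi]; split; apply: measurable_funM.
- exact: (measurableT_comp (@measurable_expR R) mr).
- by apply: (measurableT_comp _ mi); apply: continuous_measurable_fun;
    exact: continuous_cos.
- exact: (measurableT_comp (@measurable_expR R) mr).
- by apply: (measurableT_comp _ mi); apply: continuous_measurable_fun;
    exact: continuous_sin.
Qed.

End Approximation.

(** For d > 0, E e^Z is compared with its discretization [A], then with [At], where the points are
    shrunk by t < 1, then with the centered version, at costs 2K, K and K. Shrinking brings the
    spread d + s strictly below d, hence below [d0] even when d equals [d0]. *)
Lemma mgf_bound_approx (R : realType) (disp : measure_display)
    (T : measurableType disp) (P : probability T R) (Z : T -> R[i]) (d M : R) :
  complex_rv Z -> centered P Z -> diam P Z = d%:E -> (d%:E <= d0 R)%E ->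
  0 <= M -> P [set w | M < normc (Z w)] = 0%E ->
  forall e, 0 < e -> normc (complex_expectation P (fun w => cexp (Z w)) - 1) <=
    G d + 4 * (expR M * (expR e - 1)).
Proof.
move=> rvZ [_ EZ] dE dd0 M0 PM e e0.
have d_ge0 : 0 <= d by exact: diam_ge0 dE.
have e1 : 0 <= expR e - 1 by rewrite subr_ge0 -expR0 ler_expR ltW.
set K := expR M * (expR e - 1).
have eK : expR e - 1 <= K by rewrite ler_peMl// -expR0 ler_expR.
(* The term e/(M + 1) makes the displacement (1 - t) M at most e, and 1/2 keeps t positive. *)
pose t := 1 - Num.min (2^-1) (e / (M + 1)).
have M1 : 0 < M + 1 by lra.
have tmin : 0 < Num.min (2^-1) (e / (M + 1)).
  by rewrite lt_min invr_gt0 ltr0n divr_gt0.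
have t1 : t < 1 by rewrite /t; lra.
have t0 : 0 < t.
  have : Num.min (2^-1) (e / (M + 1)) <= 2^-1 by rewrite ge_min lexx.
  by rewrite /t; lra.
have tM : (1 - t) * M <= e.
  have : 1 - t <= e / (M + 1) by rewrite /t opprB addrCA subrr addr0 ge_min lexx orbT.
  by rewrite ler_pdivlMr//; nra.
(* s <= e/2 controls the discretization error, and s <= (1 - t) d / 2 gives t (d + s) < d; for d = 0
   the latter would force s <= 0. *)
pose s := if d == 0 then e / 2 else Num.min (e / 2) ((1 - t) * d / 2).
have s0 : 0 < s.
  rewrite /s; case: eqVneq => [_|dn0]; first by rewrite divr_gt0.
  by rewrite lt_min !divr_gt0// mulr_gt0 ?subr_gt0// lt_neqAle eq_sym dn0.
have se : s <= e / 2 by rewrite /s; case: ifP => _ //; rewrite ge_min lexx.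
have [I [iota [y [miota ae_y sy yM]]]] :=
  discretize rvZ (fun c => diam_spread_ae rvZ dE) PM s0.
set p := image_law P iota in sy yM *.
have lp : is_law p by exact: image_law_law.
have [p0 p1] := lp.
pose A := mean p (fun i => cexp (y i)).
have EA : normc (complex_expectation P (fun w => cexp (Z w)) - A) <= 2 * K.
  apply: complex_expectation_approx => //; first exact: complex_rv_cexp.
    exact: le_trans eK.
  apply: filterS ae_y => w [ZM Zy]; rewrite normcB; apply: cexp_dist => //.
  by rewrite normcB; apply: le_trans Zy _; lra.
have my : normc (mean p y) <= e.
  have : normc (complex_expectation P Z - mean p y) <= 2 * s.
    apply: complex_expectation_approx => //; first exact: ltW.
    by apply: filterS ae_y => w [].
  by rewrite EZ sub0r normcN; lra.
have tri3 (a b c : R[i]) (x x' : R) : normc (a - b) <= x -> normc (b - c) <= x' ->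
    normc (a - c) <= x + x'.
  move=> h1 h2; have -> : a - c = (a - b) + (b - c) by ring.
  exact: le_trans (le_normcD _ _) (lerD h1 h2).
suff : normc (A - 1) <= G d + 2 * K.
  move=> A1; apply: le_trans (tri3 _ _ _ _ _ EA A1) _; lra.
(* If d = 0, the points of positive mass lie within s of each other, so the centered mean is
   directly close to 1, and G 0 = 0. *)
have [d_eq0|dn0] := eqVneq d 0.
  have AC : normc (A - centered_mgf p y) <= K by exact: mgf_centering.
  suff C1 : normc (centered_mgf p y - 1) <= K.
    by rewrite {1}/G d_eq0 eqxx; apply: le_trans (tri3 _ _ _ _ _ AC C1) _; lra.
  apply: le_trans eK.
  have -> : 1 = mean p (fun=> 1) :> R[i].
    by rewrite /mean; under eq_bigr do rewrite mulr1; rewrite -rmorph_sum /= p1.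
  apply: (mean_dist lp) => i pi; apply: le_trans (normc_cexpB1_le _) _.
  rewrite lerD2r ler_expR.
  have -> : y i = mean p (fun=> y i).
    by rewrite /mean -mulr_suml -rmorph_sum /= p1 mul1r.
  apply: (mean_dist lp) => j pj; apply: le_trans (sy _ _ pi pj) _.
  by rewrite d_eq0; lra.
have d_gt0 : 0 < d by rewrite lt_neqAle eq_sym dn0.
pose yt i := t%:C * y i.
have mt : mean p yt = t%:C * mean p y.
  by rewrite /mean mulr_sumr; apply: eq_bigr => i _; rewrite /yt mulrCA.
have nt (z : R[i]) : normc (t%:C * z) = t * normc z.
  by rewrite normcM normc_real ger0_norm// ltW.
have ytM i : 0 < p i -> normc (yt i) <= M.
  move=> pi; rewrite nt; apply: le_trans (yM _ pi).
  by rewrite ler_piMl ?normc_ge0// ltW.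
pose At := mean p (fun i => cexp (yt i)).
have AAt : normc (A - At) <= K.
  apply: (mean_dist lp) => i pi; apply: cexp_dist; first exact: ytM.
  have -> : y i - yt i = (1 - t)%:C * y i by rewrite rmorphB mulrBl mul1r.
  rewrite normcM normc_real ger0_norm ?subr_ge0 ?(ltW t1)//.
  by apply: le_trans tM; rewrite ler_wpM2l ?subr_ge0 ?(ltW t1)// yM.
have AtC : normc (At - centered_mgf p yt) <= K.
  apply: mgf_centering => //; rewrite mt nt; apply: le_trans my.
  by rewrite ler_piMl ?normc_ge0// ltW.
pose d1 := t * (d + s).
have sd : s <= (1 - t) * d / 2.
  by rewrite /s (negbTE dn0) ge_min lexx orbT.
have d1d : d1 < d.
  have : t * s <= s by rewrite ler_piMl// ltW.
  have : 0 < (1 - t) * d by rewrite mulr_gt0// subr_gt0.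
  by rewrite /d1; lra.
have [r d1r Hr] : exists2 r, d1 < r & mgf_Re_ge0 r.
  by apply: lt_d0_mgf_Re_ge0; apply: lt_le_trans dd0; rewrite lte_fin.
have C1 : normc (centered_mgf p yt - 1) <= G d.
  apply: (finite_law_bound d_gt0 (ltW d1d) d1r Hr lp) => i j pi pj.
  by rewrite -mulrBr nt ler_wpM2l ?(ltW t0)// sy.
apply: le_trans (tri3 _ _ _ _ _ AAt (tri3 _ _ _ _ _ AtC C1)) _; lra.
Qed.

Theorem theorem2p1 (R : realType) (disp : measure_display)
    (T : measurableType disp) (P : probability T R)
    (Z : T -> R[i]) (d : R) :
  complex_rv Z -> centered P Z -> diam P Z = d%:E -> (d%:E <= d0 R)%E ->
  `|complex_expectation P (fun w => cexp (Z w)) - 1| <= (G d)%:C.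
Proof.
move=> rvZ cZ dE dd0; rewrite -[`|_|]/((normc _)%:C) lecR.
have d1 : d < d + 1 by lra.
have [M M0 PM] := spread_ae_bounded rvZ (diam_spread_ae rvZ dE d1).
apply/ler_addgt0Pr => e e0.
pose K := 4 * expR M; have K0 : 0 < K by rewrite mulr_gt0// expR_gt0.
have eK : 0 < e / K by rewrite divr_gt0.
(* Taken as the accuracy, ln (1 + e / K) turns the error term into exactly e. *)
have l0 : 0 < ln (1 + e / K) by rewrite ln_gt0//; lra.
have := mgf_bound_approx rvZ cZ dE dd0 M0 PM l0.
rewrite lnK ?posrE; last lra.
by rewrite mulrA addrAC subrr add0r -/K mulrC mulfVK ?gt_eqF.
Qed.
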